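(* Let $Z$ be a Banach space with a shrinking, unconditional basis satisfying an upper $p$-estimate for some $p > 1$. Then there exists an isomorphically polyhedral Banach space with an unconditional basis which admits a quotient isomorphic to $Z$.
   Context: Banach spaces are over the real field. A Banach space is polyhedral if the closed unit ball of each of its finite-dimensional subspaces has finitely many extreme points; it is isomorphically polyhedral if it is polyhedral under an equivalent norm. A Schauder basis $(z_n)$ of $Z$ is shrinking if the sequence $(z_n^* )$ of functionals biorthogonal to $(z_n)$ is a Schauder basis of $Z^*$. A block of $(z_n)$ is a non-zero finite linear combination $u=\sum_{i\in F} a_i z_i$ with $F\subset\mathbb{N}$ finite and all $a_i\neq 0$; $F$ is its support. A Banach space with an unconditional basis $(z_n)$ satisfies an upper $p$-estimate ($p>1$) if there is a constant $C>0$ such that $\|\sum_{i=1}^n u_i\|\le C(\sum_{i=1}^n\|u_i\|^p)^{1/p}$ for every $n$ and every choice $(u_i)_{i=1}^n$ of disjointly supported blocks of $(z_n)$. *)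

(* Defs.v *)
From HB Require Import structures.
From mathcomp Require Import all_boot all_order all_algebra.
From mathcomp Require Import finmap generic_quotient.
From mathcomp Require Import all_classical all_reals all_analysis.

Set Implicit Arguments.
Unset Strict Implicit.
Unset Printing Implicit Defensive.

Import Order.TTheory GRing.Theory Num.Theory.
Import numFieldNormedType.Exports.

Local Open Scope classical_set_scope.
Local Open Scope ring_scope.

Section Dual.
Variables (R : realType) (X : normedModType R).

Definition continuous_functional : {pred X -> R^o} :=
  [pred f : X -> R^o | `[< linear f /\ continuous f >]].

Lemma continuous_functional_submod_closed : submod_closed continuous_functional.
Proof.
split=> [|c f g /asboolP[lf cf] /asboolP[lg cg]]; apply/asboolP; split.
- by move=> a x y; rewrite -[RHS]/(a *: 0 + 0) scaler0 addr0.
- by move=> x; exact: cst_continuous.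
- move=> a x y; rewrite -[LHS]/(c *: f (a *: x + y) + g (a *: x + y)) lf lg.
  by rewrite -[RHS]/(a *: (c *: f x + g x) + (c *: f y + g y))
    !scalerDr !scalerA (mulrC a c) addrACA.
- move=> x; apply: continuousD; last exact: cg.
  by apply: continuousZr; exact: cf.
Qed.

HB.instance Definition _ := GRing.isSubmodClosed.Build _ _ continuous_functional
  continuous_functional_submod_closed.

Record dual := Dual {
  dual_fun :> X -> R^o;
  dual_funP : dual_fun \in continuous_functional }.

HB.instance Definition _ := [isSub for dual_fun].
HB.instance Definition _ := [Choice of dual by <:].
HB.instance Definition _ := [SubChoice_isSubLmodule of dual by <:].

Definition dual_norm (f : dual) : R := sup [set `|f x| | x in [set x | `|x| <= 1]].

Lemma dual_linear (f : dual) : linear f.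
Proof. by case: f => f /= /asboolP[]. Qed.

HB.instance Definition _ (f : dual) :=
  GRing.isLinear.Build R X R^o *:%R f (dual_linear f).

Lemma dual_continuous (f : dual) : continuous f.
Proof. by case: f => f /= /asboolP[]. Qed.

Lemma dual_norm_has_sup (f : dual) :
  has_sup [set `|f x| | x in [set x | `|x| <= 1]].
Proof.
split; first by exists `|f 0|, 0; rewrite //= normr0.
have /bounded_funP/(_ 1)[M fM] :=
  (linear_bounded_continuous f).2 (@dual_continuous f).
by exists M => _ [x x1 <-]; exact: fM.
Qed.

Lemma ler_dual_norm (f : dual) x : `|x| <= 1 -> `|f x| <= dual_norm f.
Proof.
by move=> x1; apply: (sup_upper_bound (dual_norm_has_sup f)); exists x.
Qed.

Lemma dual_norm_le (f : dual) M :
  (forall x, `|x| <= 1 -> `|f x| <= M) -> dual_norm f <= M.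
Proof.
move=> fM; apply: ge_sup; first exact: (dual_norm_has_sup f).1.
by move=> _ [x x1 <-]; exact: fM.
Qed.

Lemma dual_normD (f g : dual) : dual_norm (f + g) <= dual_norm f + dual_norm g.
Proof.
apply: dual_norm_le => x x1.
by apply: le_trans (ler_normD _ _) _; rewrite lerD ?ler_dual_norm.
Qed.

Lemma dual_norm_leZ (a : R) (f : dual) : dual_norm (a *: f) <= `|a| * dual_norm f.
Proof.
apply: dual_norm_le => x x1.
by rewrite [X in `|X|](_ : _ = a * f x)// normrM ler_wpM2l ?ler_dual_norm.
Qed.

Lemma dual_normZ (a : R) (f : dual) : dual_norm (a *: f) = `|a| * dual_norm f.
Proof.
apply/eqP; rewrite eq_le dual_norm_leZ/=.
have [->|a0] := eqVneq a 0.
  rewrite normr0 mul0r; apply: le_trans (ler_dual_norm _ (x := 0) _) => //.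
  by rewrite normr0.
rewrite -ler_pdivlMl ?normr_gt0// -normfV.
by have := dual_norm_leZ a^-1 (a *: f); rewrite scalerA mulVf// scale1r.
Qed.

Lemma dual_norm_eq0 (f : dual) : dual_norm f = 0 -> f = 0.
Proof.
move=> f0; apply/val_inj/funext => x /=.
have [->|x0] := eqVneq x 0; first by rewrite linear0.
have := @ler_dual_norm f (`|x|^-1 *: x).
rewrite normfZV// f0 => /(_ (lexx _)); rewrite linearZ/= normr_le0.
by rewrite scaler_eq0 invr_eq0 normr_eq0 (negPf x0) => /eqP.
Qed.

HB.instance Definition _ := Lmodule_isNormed.Build R dual
  dual_normD dual_normZ dual_norm_eq0.

End Dual.

Record closedSubspace (R : realType) (X : normedModType R) := ClosedSubspace {
  subspace_pred :> submodClosed X;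
  closed_subspace : closed [set x | x \in subspace_pred] }.

Section QuotientSpace.
Variables (R : realType) (X : normedModType R) (M : closedSubspace X).
Local Open Scope quotient_scope.

Definition coset_eq (x y : X) : bool := x - y \in (M : submodClosed X).

Lemma coset_eq_refl : reflexive coset_eq.
Proof. by move=> x; rewrite /coset_eq subrr rpred0. Qed.

Lemma closed_subspaceN x : (- x \in (M : submodClosed X)) = (x \in (M : submodClosed X)).
Proof.
suff N y : y \in (M : submodClosed X) -> - y \in (M : submodClosed X).
  by apply/idP/idP => /N //; rewrite opprK.
by rewrite -scaleN1r => yM; rewrite rpredZ.
Qed.

Lemma coset_eq_sym : symmetric coset_eq.
Proof. by move=> x y; rewrite /coset_eq -opprB closed_subspaceN. Qed.

Lemma coset_eq_trans : transitive coset_eq.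
Proof.
by move=> y x z xy yz; rewrite /coset_eq -(subrKA y) rpredD.
Qed.

Canonical coset_equiv := EquivRel coset_eq coset_eq_refl coset_eq_sym coset_eq_trans.

Definition quotient_space : Type := {eq_quot coset_eq}.
HB.instance Definition _ := Choice.on quotient_space.
HB.instance Definition _ := EqQuotient.on quotient_space.

Definition coset (x : X) : quotient_space := \pi x.

Definition quot_add (u v : quotient_space) := coset (repr u + repr v).
Definition quot_opp (u : quotient_space) := coset (- repr u).
Definition quot_scale (a : R) (u : quotient_space) := coset (a *: repr u).

Lemma cosetP x y : coset x = coset y <-> x - y \in (M : submodClosed X).
Proof.
by split=> [/eqmodP//|xy]; apply/eqmodP.
Qed.

Lemma repr_coset x : repr (coset x) - x \in (M : submodClosed X).
Proof. by apply/cosetP; rewrite /coset reprK. Qed.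

Lemma coset_surj u : exists x, u = coset x.
Proof. by exists (repr u); rewrite /coset reprK. Qed.

Lemma quot_addE x y : quot_add (coset x) (coset y) = coset (x + y).
Proof. by apply/cosetP; rewrite opprD addrACA rpredD// repr_coset. Qed.

Lemma quot_oppE x : quot_opp (coset x) = coset (- x).
Proof. by apply/cosetP; rewrite -opprD closed_subspaceN repr_coset. Qed.

Lemma quot_scaleE a x : quot_scale a (coset x) = coset (a *: x).
Proof. by apply/cosetP; rewrite -scalerBr rpredZ// repr_coset. Qed.

Lemma quot_addA : associative quot_add.
Proof.
move=> u v w; have [[x ->] [y ->] [z ->]] :=
  And3 (coset_surj u) (coset_surj v) (coset_surj w).
by rewrite !quot_addE addrA.
Qed.

Lemma quot_addC : commutative quot_add.
Proof.
by move=> u v; rewrite /quot_add addrC.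
Qed.

Lemma quot_add0 : left_id (coset 0) quot_add.
Proof. by move=> u; have [x ->] := coset_surj u; rewrite quot_addE add0r. Qed.

Lemma quot_addN : left_inverse (coset 0) quot_opp quot_add.
Proof.
by move=> u; have [x ->] := coset_surj u; rewrite quot_oppE quot_addE addNr.
Qed.

HB.instance Definition _ := GRing.isZmodule.Build quotient_space
  quot_addA quot_addC quot_add0 quot_addN.

Lemma cosetD x y : coset (x + y) = coset x + coset y.
Proof. by rewrite -quot_addE. Qed.

Lemma quot_scaleA a b u : quot_scale a (quot_scale b u) = quot_scale (a * b) u.
Proof. by have [x ->] := coset_surj u; rewrite !quot_scaleE scalerA. Qed.

Lemma quot_scale1 : left_id 1 quot_scale.
Proof. by move=> u; have [x ->] := coset_surj u; rewrite quot_scaleE scale1r. Qed.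

Lemma quot_scaleDr : right_distributive quot_scale +%R.
Proof.
move=> a u v; have [[x ->] [y ->]] := conj (coset_surj u) (coset_surj v).
by rewrite -cosetD !quot_scaleE -cosetD scalerDr.
Qed.

Lemma quot_scaleDl u : {morph quot_scale^~ u : a b / a + b}.
Proof.
move=> a b /=; have [x ->] := coset_surj u.
by rewrite !quot_scaleE -cosetD scalerDl.
Qed.

HB.instance Definition _ := GRing.Zmodule_isLmodule.Build R quotient_space
  quot_scaleA quot_scale1 quot_scaleDr quot_scaleDl.

Lemma cosetZ a x : coset (a *: x) = a *: coset x.
Proof. by rewrite -quot_scaleE. Qed.

Definition quot_norm (u : quotient_space) : R :=
  inf [set `|x| | x in [set x | coset x = u]].

Lemma quot_norm_has_inf u : has_inf [set `|x| | x in [set x | coset x = u]].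
Proof.
split; last by exists 0 => _ [x _ <-].
by have [x ->] := coset_surj u; exists `|x|, x.
Qed.

Lemma quot_norm_le u x : coset x = u -> quot_norm u <= `|x|.
Proof. by move=> xu; apply: (ge_inf (quot_norm_has_inf u).2); exists x. Qed.

Lemma quot_norm_ge0 u : 0 <= quot_norm u.
Proof.
by apply: lb_le_inf (quot_norm_has_inf u).1 _ => _ [x _ <-].
Qed.

Lemma quot_norm_lt u e : 0 < e -> exists2 x, coset x = u & `|x| < quot_norm u + e.
Proof.
by move=> e0; have [_ [x xu <-] ?] := inf_adherent e0 (quot_norm_has_inf u); exists x.
Qed.

Lemma quot_normD u v : quot_norm (u + v) <= quot_norm u + quot_norm v.
Proof.
apply/ler_addgt0Pr => e e0; have e2 : 0 < e / 2 by rewrite divr_gt0.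
have [x xu xe] := quot_norm_lt u e2; have [y yv ye] := quot_norm_lt v e2.
apply: (@le_trans _ _ `|x + y|); first by apply: quot_norm_le; rewrite cosetD xu yv.
by apply: le_trans (ler_normD _ _) _; rewrite [e]splitr addrACA lerD// ltW.
Qed.

Lemma quot_norm_leZ a u : quot_norm (a *: u) <= `|a| * quot_norm u.
Proof.
have [->|a0] := eqVneq a 0.
  rewrite scale0r normr0 mul0r -(@normr0 _ X).
  exact: quot_norm_le.
rewrite -ler_pdivrMl ?normr_gt0//.
apply: lb_le_inf (quot_norm_has_inf u).1 _ => _ [x xu <-].
rewrite ler_pdivrMl ?normr_gt0// -normrZ; apply: quot_norm_le.
by rewrite cosetZ xu.
Qed.

Lemma quot_normZ a u : quot_norm (a *: u) = `|a| * quot_norm u.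
Proof.
apply/eqP; rewrite eq_le quot_norm_leZ/=.
have [->|a0] := eqVneq a 0; first by rewrite normr0 mul0r quot_norm_ge0.
rewrite -ler_pdivlMl ?normr_gt0// -normfV.
by have := quot_norm_leZ a^-1 (a *: u); rewrite scalerA mulVf// scale1r.
Qed.

Lemma quot_norm_eq0 u : quot_norm u = 0 -> u = 0.
Proof.
have [x ->] := coset_surj u => x0; apply/cosetP; rewrite subr0.
have := @closed_subspace _ _ M; rewrite closure_id => /seteqP[_]; apply.
move=> B /nbhs_normP[e /= e0 eB].
have [y yx] := quot_norm_lt (coset x) e0; rewrite x0 add0r => ye.
exists (x - y); split; first by move/esym/cosetP : yx.
by apply: eB; rewrite /= opprB addrC subrK.
Qed.

HB.instance Definition _ := Lmodule_isNormed.Build R quotient_space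
  quot_normD quot_normZ quot_norm_eq0.

End QuotientSpace.

Section Definitions.
Variable R : realType.

Definition isomorphic (V W : normedModType R) : Prop :=
  exists (f : {linear V -> W}) (g : {linear W -> V}),
    [/\ continuous f, continuous g, cancel f g & cancel g f].

Definition schauder_basis (V : normedModType R) (e : nat -> V) : Prop :=
  forall x : V, exists! a : nat -> R, series (fun n => a n *: e n) @ \oo --> x.

Definition unconditionally_convergent (V : normedModType R) (u : nat -> V) : Prop :=
  forall s : nat -> nat, bijective s -> cvgn (series (u \o s)).

Definition unconditional_basis (V : normedModType R) (e : nat -> V) : Prop :=
  schauder_basis e /\
  forall (x : V) (a : nat -> R), series (fun n => a n *: e n) @ \oo --> x ->
    unconditionally_convergent (fun n => a n *: e n).

(* The biorthogonal functionals of a basis are unique, so "exists" is "the". *)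
Definition shrinking_basis (V : normedModType R) (e : nat -> V) : Prop :=
  schauder_basis e /\
  exists f : nat -> dual V,
    (forall m n, f m (e n) = (m == n)%:R) /\ schauder_basis f.

Definition block (V : normedModType R) (e : nat -> V) (F : {fset nat}) (u : V) : Prop :=
  u != 0 /\
  exists a : nat -> R,
    (forall i, i \in F -> a i != 0) /\ u = \sum_(i <- F) a i *: e i.

Definition upper_estimate (p : R) (V : normedModType R) (e : nat -> V) : Prop :=
  exists C : R, 0 < C /\
    forall (n : nat) (u : 'I_n -> V) (F : 'I_n -> {fset nat}),
      (forall i, block e (F i) (u i)) ->
      (forall i j, i != j -> [disjoint F i & F j]%fset) ->
      `|\sum_(i < n) u i| <= C * (\sum_(i < n) `|u i| `^ p) `^ p^-1.

Definition extreme_points (V : lmodType R) (A : set V) : set V :=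
  [set x | A x /\ forall (y z : V) (t : R), A y -> A z -> 0 < t < 1 ->
    x = t *: y + (1 - t) *: z -> y = x /\ z = x].

Definition finite_dim_subspace (V : lmodType R) (E : set V) : Prop :=
  exists (n : nat) (v : 'I_n -> V),
    E = [set x | exists a : 'I_n -> R, x = \sum_(i < n) a i *: v i].

Definition polyhedral_norm (V : lmodType R) (N : V -> R) : Prop :=
  forall E : set V, finite_dim_subspace E ->
    finite_set (extreme_points [set x | E x /\ N x <= 1]).

Definition polyhedral (V : normedModType R) : Prop :=
  polyhedral_norm (fun x : V => `|x|).

Definition is_norm (V : lmodType R) (N : V -> R) : Prop :=
  [/\ forall x y, N (x + y) <= N x + N y,
      forall a x, N (a *: x) = `|a| * N x &
      forall x, N x = 0 -> x = 0].

Definition equivalent_norm (V : normedModType R) (N : V -> R) : Prop :=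
  is_norm N /\
  exists c C : R, [/\ 0 < c, 0 < C & forall x, c * `|x| <= N x <= C * `|x|].

Definition isomorphically_polyhedral (V : normedModType R) : Prop :=
  exists N : V -> R, equivalent_norm N /\ polyhedral_norm N.

End Definitions.

(* Main.v *)
Require Import Defs.
From HB Require Import structures.
From mathcomp Require Import all_boot all_order all_algebra.
From mathcomp Require Import finmap.
From mathcomp Require Import ring lra.
From mathcomp Require Import all_classical all_reals all_analysis.
Import Order.TTheory GRing.Theory Num.Theory.
Import numFieldNormedType.Exports.

Set Implicit Arguments.
Unset Strict Implicit.
Unset Printing Implicit Defensive.

Local Open Scope classical_set_scope.
Local Open Scope ring_scope.

(** Why it is true.  Call a coefficient sequence solid if all its sign changes and
restrictions define vectors of norm at most 1 in Z.  Let T be the tree of the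
finite solid sequences c = (c_0, ..., c_m) with entries on a fine grid, ordered
by initial segments; the level of c is m, and every level is finite.  The space
X consists of functions x on T and is normed by the sums of |x_t| over the
antichains A that occupy few levels, namely at most width m of them if A meets
level m.  The map Q from X to Z sends the unit vector at c to c_m z_m.

Q is onto because the indicator of the branch leading to c is sent to the sum of
the c_i z_i, while an antichain meets a branch at most once (branch_norm).
Rounding to the grid shows that every vector of Z is nearly the image of a
multiple of such an indicator (grid_approximation), and iterating on the
remainders gives exact preimages of comparable norm (approx_lift).

That Q is bounded is the heart of the matter, and the place where p > 1 enters.
By duality one has to bound S, the sum over t = (c_0, ..., c_m) of
a_m |c_m| |x_t|, by a multiple of the norm of x, where a is the coefficient
sequence of a functional.  The upper p-estimate allows a to range over the set
upper_dual, for which the upper p-estimate holds with constant one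
(norming_upper_dual).  Choose a in this set so that S is nearly maximal, and let
nu_m be the share of level m in S, a probability on the levels.  Nodes with
a_m |c_m| <= 4 nu_m contribute little since each level is an antichain.
Consider the nodes with a_m |c_m| about 2^j nu_m.  Near maximality of a forces
the levels of those among them that lie on one branch to have nu-measure of
order 2^(-pj) (small_measure).  Draw about 2^(pj) levels at random with law nu
and keep the first node of the class on each branch that lies on a drawn level:
this is an antichain on few levels, and it keeps the node t with probability of
order 2^(pj) nu_m (sampled_antichain).  Hence the class contributes at most a
multiple of 2^j 2^(-pj) to S, and these bounds are summable because p > 1.  Only
the first j levels may be too early for so many levels to be allowed, and each
of them contributes at most a multiple of 2^j 2^(-pj).

X is polyhedral once each sum over A is multiplied by the weight
1 + 1 / (1 + number of levels of A).  On a finite-dimensional subspace the far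
coordinates are uniformly negligible, so dropping the late levels of A loses
less than the weight gains, and finitely many sets A determine the norm
(finitely_many_sets).  Finally the unit vectors form an unconditional basis,
since the norm depends only on the |x_t| and the tails of an element of X tend
to 0. *)

(** * Sequence spaces normed by a weighted family of finite sets *)

Lemma ler_sum_subset (R : numDomainType) (I : eqType) (s s' : seq I)
    (P Q : pred I) (f : I -> R) :
  (forall i, 0 <= f i) -> uniq s ->
  (forall i, i \in s -> P i -> (i \in s') && Q i) ->
  \sum_(i <- s | P i) f i <= \sum_(i <- s' | Q i) f i.
Proof.
move=> f0 us sub; rewrite -big_filter -[leRHS]big_filter.
have {sub} : {subset [seq i <- s | P i] <= [seq i <- s' | Q i]}.
  by move=> i; rewrite !mem_filter => /andP[Pi /sub/(_ Pi)]; rewrite andbC.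
move: [seq i <- s' | Q i] [seq i <- s | P i] (filter_uniq P us) => {us}s' {}s.
elim: s s' => [|i s IH] s' /=; first by rewrite big_nil sumr_ge0.
move=> /andP[iNs us] sub; rewrite big_cons.
rewrite [leRHS](big_rem i) ?sub ?mem_head//= lerD2l IH// => j js.
have ji : j != i by apply: contraNneq iNs => <-.
by rewrite (rem_mem ji)// sub// inE js orbT.
Qed.

Lemma dist_le_continuous (R : realType) (V W : normedModType R) (f : V -> W)
    (C : R) : (forall x y, `|f x - f y| <= C * `|x - y|) -> continuous f.
Proof.
move=> fC x; apply/cvgrPdist_le => e e0.
have C0 : 0 < `|C| + 1 by rewrite ltr_pwDr.
apply/nbhs_normP; exists (e / (`|C| + 1)) => /=; first by rewrite divr_gt0.
move=> y /=; rewrite ltr_pdivlMr// mulrC => /ltW xy.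
apply: le_trans xy; apply: (le_trans (fC x y)).
by rewrite ler_wpM2r// (le_trans (ler_norm _))// lerDl.
Qed.

(** The bounds on the weights make the weighted norm equivalent to the unweighted
one; the freedom left is used to make the norm polyhedral. *)
Record weighted_family (R : realType) := WeightedFamily {
  fam : {fset nat} -> Prop;
  wt : {fset nat} -> R;
  fam_single : forall i, fam [fset i]%fset;
  wt_ge1 : forall A, 1 <= wt A;
  wt_le2 : forall A, wt A <= 2 }.

Section FamilySpace.
Variables (R : realType) (F : weighted_family R).
Implicit Types (x y : nat -> R) (A : {fset nat}).

(** The closure of the finitely supported sequences. *)
Definition vanishing_tails : {pred nat -> R^o} :=
  [pred x | `[< forall e : R, 0 < e -> exists k, forall A, fam F A ->
     \sum_(i <- A | (k <= i)%N) `|x i : R| <= e >]].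

Lemma vanishing_tails_submod_closed : submod_closed vanishing_tails.
Proof.
split=> [|c x y /= /asboolP xv /asboolP yv]; apply/asboolP => e e0.
  exists 0%N => A _; rewrite big1 ?ltW// => i _.
  by rewrite [X in `|X|](_ : _ = 0)// normr0.
have c0 : 0 < `|c| + 1 by rewrite ltr_pwDr.
have [k xk] := xv (e / 2 / (`|c| + 1)) ltac:(by rewrite !divr_gt0).
have [l yl] := yv (e / 2) ltac:(by rewrite !divr_gt0).
exists (maxn k l) => A FA.
have le z m : (m <= maxn k l)%N ->
    \sum_(i <- A | (maxn k l <= i)%N) `|z i| <= \sum_(i <- A | (m <= i)%N) `|z i : R|.
  move=> ml; rewrite big_mkcond [leRHS]big_mkcond; apply: ler_sum => i _.
  by case: ifPn => [/(leq_trans ml) ->//|_]; case: ifP.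
apply: (@le_trans _ _ (`|c| * \sum_(i <- A | (maxn k l <= i)%N) `|x i| +
                       \sum_(i <- A | (maxn k l <= i)%N) `|y i|)).
  rewrite mulr_sumr -big_split/=; apply: ler_sum => i _.
  by rewrite -normrM; exact: ler_normD.
have {xk}/(le_trans (le x k (leq_maxl _ _))) xk := xk A FA.
have {yl}/(le_trans (le y l (leq_maxr _ _))) yl := yl A FA.
rewrite [e]splitr lerD//; move: xk; rewrite ler_pdivlMr// mulrDr mulr1 mulrC.
by apply: le_trans; rewrite lerDl sumr_ge0.
Qed.

HB.instance Definition _ := GRing.isSubmodClosed.Build _ _ vanishing_tails
  vanishing_tails_submod_closed.

Record family_space := FamilySpace {
  entry : nat -> R^o;
  entry_vanishing : entry \in vanishing_tails }.

HB.instance Definition _ := [isSub for entry].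
HB.instance Definition _ := [Choice of family_space by <:].
HB.instance Definition _ := [SubChoice_isSubLmodule of family_space by <:].

Implicit Types (u v : family_space).

(** The entries as elements of R instead of R^o, so that the lemmas on real
numbers apply to them. *)
Definition coef u : nat -> R := entry u.
Coercion coef : family_space >-> Funclass.

Arguments coef : simpl never.

Lemma coefD u v i : coef (u + v) i = u i + v i. Proof. by []. Qed.
Lemma coefB u v i : coef (u - v) i = u i - v i. Proof. by []. Qed.
Lemma coefZ (a : R) u i : coef (a *: u) i = a * u i. Proof. by []. Qed.
Lemma coef_bigsum (I : Type) (r : seq I) (P : pred I) (f : I -> family_space) i :
  coef (\sum_(j <- r | P j) f j) i = \sum_(j <- r | P j) f j i.
Proof.
by elim/big_rec2 : _ => // j a b _ <-; rewrite coefD.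
Qed.

Lemma tail_small u (e : R) : 0 < e -> exists k, forall A, fam F A ->
  \sum_(i <- A | (k <= i)%N) `|u i| <= e.
Proof. by case: u => x xv; exact: (asboolP _ xv). Qed.

Definition wsum A x : R := wt F A * \sum_(i <- A) `|x i|.

Lemma wt_gt0 A : 0 < wt F A.
Proof. by apply: lt_le_trans (wt_ge1 _ _). Qed.

Lemma sum_le_wsum A x : \sum_(i <- A) `|x i| <= wsum A x.
Proof. by rewrite /wsum ler_peMl ?wt_ge1// sumr_ge0. Qed.

Lemma wsum_le_sum A x : wsum A x <= 2 * \sum_(i <- A) `|x i|.
Proof. by rewrite /wsum ler_wpM2r ?wt_le2// sumr_ge0. Qed.

Definition family_norm u : R := sup [set wsum A u | A in fam F].

Lemma family_norm_has_sup u : has_sup [set wsum A u | A in fam F].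
Proof.
split; first by exists (wsum [fset 0%N]%fset u), [fset 0%N]%fset => //; exact: fam_single.
have [k uk] := tail_small u (@ltr01 R).
exists (2 * (\sum_(i < k) `|u i| + 1)) => _ [A FA <-].
apply: le_trans (wsum_le_sum _ _) _; rewrite ler_pM2l//.
rewrite (bigID (fun i => (k <= i)%N))/= addrC lerD ?uk//.
rewrite -(big_mkord xpredT (fun i => `|u i|)).
apply: ler_sum_subset; rewrite ?fset_uniq// => i _; rewrite -ltnNge => ik.
by rewrite mem_index_iota ik.
Qed.

Lemma wsum_le_norm u A : fam F A -> wsum A u <= family_norm u.
Proof.
by move=> FA; apply: (sup_upper_bound (family_norm_has_sup u)); exists A.
Qed.

Lemma family_norm_le u (M : R) :
  (forall A, fam F A -> wsum A u <= M) -> family_norm u <= M.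
Proof.
move=> uM; apply: ge_sup; first exact: (family_norm_has_sup u).1.
by move=> _ [A FA <-]; exact: uM.
Qed.

Lemma family_norm_gt u (M : R) : M < family_norm u ->
  exists2 A, fam F A & M < wsum A u.
Proof.
move=> Mu; have [A /not_implyP[FA /negP]] : exists A, ~ (fam F A -> wsum A u <= M).
  apply/existsNP => uM; move: Mu; rewrite ltNge => /negP; apply.
  exact: family_norm_le.
by rewrite -ltNge => MA; exists A.
Qed.

Lemma coef_le_family_norm u i : `|u i| <= family_norm u.
Proof.
apply: le_trans (wsum_le_norm u (fam_single F i)).
by apply: le_trans (sum_le_wsum _ _); rewrite big_seq_fset1.
Qed.

Lemma family_normD u v : family_norm (u + v) <= family_norm u + family_norm v.
Proof.
apply: family_norm_le => A FA.
apply: le_trans (lerD (wsum_le_norm u FA) (wsum_le_norm v FA)).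
rewrite /wsum -mulrDr ler_wpM2l ?(ltW (wt_gt0 _))// -big_split/=.
by apply: ler_sum => i _; exact: ler_normD.
Qed.

Lemma wsumZ A (a : R) u : wsum A (coef (a *: u)) = `|a| * wsum A u.
Proof.
rewrite /wsum mulrCA; congr (_ * _); rewrite mulr_sumr.
by apply: eq_bigr => i _; rewrite coefZ normrM.
Qed.

Lemma family_norm_leZ (a : R) u : family_norm (a *: u) <= `|a| * family_norm u.
Proof.
by apply: family_norm_le => A FA; rewrite wsumZ ler_wpM2l ?wsum_le_norm.
Qed.

Lemma family_normZ (a : R) u : family_norm (a *: u) = `|a| * family_norm u.
Proof.
apply/eqP; rewrite eq_le family_norm_leZ/=.
have [->|a0] := eqVneq a 0.
  by rewrite normr0 mul0r (le_trans _ (coef_le_family_norm _ 0)).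
rewrite -ler_pdivlMl ?normr_gt0// -normfV.
by have := family_norm_leZ a^-1 (a *: u); rewrite scalerA mulVf// scale1r.
Qed.

Lemma family_norm_eq0 u : family_norm u = 0 -> u = 0.
Proof.
move=> u0; apply/val_inj/funext => i /=.
by apply/normr0_eq0/le_anti; rewrite normr_ge0 andbT -u0 coef_le_family_norm.
Qed.

HB.instance Definition _ := Lmodule_isNormed.Build R family_space
  family_normD family_normZ family_norm_eq0.

Lemma norm_family u : `|u| = family_norm u. Proof. by []. Qed.

Lemma wsum_le u A : fam F A -> wsum A u <= `|u|.
Proof. exact: wsum_le_norm. Qed.

Lemma coef_le_norm u i : `|u i| <= `|u|.
Proof. exact: coef_le_family_norm. Qed.

Local Notation coord i := (fun u : family_space => coef u i).

(** The coordinates of a Cauchy filter converge, and the coordinatewise limit is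
the limit in norm because each wsum involves only finitely many coordinates. *)
Lemma family_space_complete (G : set_system family_space) :
  ProperFilter G -> cauchy G -> cvg G.
Proof.
move=> PG /(cauchyP G).1 Gc.
have lP i : exists l : R, coord i @ G --> l.
  suff : cvg (coord i @ G) by move=> /cvg_ex.
  apply: R_complete; apply: cauchy_exP => e e0.
  have [u Gu] := Gc e e0; exists (u i).
  suff : G [set v | ball (u i) e (coef v i)] by [].
  apply: filterS Gu => v.
  rewrite -!ball_normE/= -coefB; exact: le_lt_trans (coef_le_norm _ _).
pose l i := projT1 (cid (lP i)).
have lE i : coord i @ G --> l i := projT2 (cid (lP i)).
have near_l (e : R) u : G (ball u e) ->
    forall A, fam F A -> wsum A (fun i => l i - u i) <= e.
  move=> Gu A FA.
  have : (fun v : family_space => wsum A (coef (v - u))) @ G --> wsum A (fun i => l i - u i).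
    apply: cvgZr; rewrite [X in _ --> X](_ : _ = \sum_(i <- A | xpredT i) `|l i - u i|)//.
    apply: cvg_big => [|i _]; first exact: add_continuous.
    apply: cvg_norm; apply: cvgB; first exact: lE.
    exact: cvg_cst.
  apply: (@closed_cvg _ _ _ _ _ (fun r : R => r <= e)); first exact: closed_le.
  apply: filterS Gu => v; rewrite -ball_normE/= distrC => /ltW.
  exact: le_trans (wsum_le _ FA).
have l_van : l \in vanishing_tails.
  apply/asboolP => e e0; have e2 : 0 < e / 2 by rewrite divr_gt0.
  have [u Gu] := Gc _ e2; have [k uk] := tail_small u e2; exists k => A FA.
  rewrite [e]splitr; apply: le_trans (lerD (near_l _ _ Gu A FA) (uk A FA)).
  apply: le_trans (lerD (sum_le_wsum _ _) (lexx _)).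
  rewrite -lerBlDr; apply: (@le_trans _ _ (\sum_(i <- A | (k <= i)%N) `|l i - u i|)).
    rewrite lerBlDr -big_split/=; apply: ler_sum => i _.
    by rewrite -{1}(subrK (u i) (l i)) ler_normD.
  by apply: ler_sum_subset => [//||i ->]; rewrite ?fset_uniq.
apply/cvg_ex; exists (FamilySpace l_van); apply/cvgrPdist_le => e e0.
have e2 : 0 < e / 2 by rewrite divr_gt0.
have [u Gu] := Gc _ e2; apply: filterS (Gu) => v; rewrite -ball_normE/= => /ltW uv.
rewrite -(subrK u (FamilySpace l_van)) -addrA [e]splitr.
apply: le_trans (ler_normD _ _) _; rewrite lerD//.
by apply: family_norm_le => A FA; exact: near_l.
Qed.

HB.instance Definition _ := Uniform_isComplete.Build family_space
  family_space_complete.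

End FamilySpace.

Arguments coef {R F} u i : simpl never.

(** * The unit vectors *)

Section UnitVectors.
Variables (R : realType) (F : weighted_family R).
Local Notation X := (family_space F).
Implicit Types (u v : X) (A : {fset nat}).

Lemma unit_vanishing j :
  (fun i => (i == j)%:R : R^o) \in vanishing_tails F.
Proof.
apply/asboolP => e e0; exists j.+1 => A _.
rewrite big1 ?ltW// => i ji; rewrite gtn_eqF ?normr0//.
Qed.

Definition unit_vec j : X := FamilySpace (unit_vanishing j).

Lemma coef_unit i j : coef (unit_vec j) i = (i == j)%:R.
Proof. by []. Qed.

Lemma coef_comb (a : nat -> R) (s : seq nat) i : uniq s ->
  coef (\sum_(j <- s) a j *: unit_vec j) i = if i \in s then a i else 0.
Proof.
move=> us; rewrite coef_bigsum; case: ifPn => [si|siN].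
  rewrite (bigD1_seq i)//= coefZ coef_unit eqxx mulr1 big1 ?addr0// => j ji.
  by rewrite coefZ coef_unit eq_sym (negPf ji) mulr0.
rewrite big_seq big1// => j js; rewrite coefZ coef_unit.
by case: eqP siN => [->|_ _]; rewrite ?js// mulr0.
Qed.

Lemma norm_le_tail u v k (e : R) :
  (forall i, (i < k)%N -> v i = 0) -> (forall i, `|v i| <= `|u i|) ->
  (forall A, fam F A -> \sum_(i <- A | (k <= i)%N) `|u i| <= e) ->
  `|v| <= 2 * e.
Proof.
move=> v0 vu ue; apply: family_norm_le => A FA.
apply: le_trans (wsum_le_sum F _ _) _; rewrite ler_pM2l//.
apply: le_trans (ue A FA); rewrite (bigID (fun i => (k <= i)%N))/=.
rewrite [X in _ + X]big1 ?addr0; last first.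
  by move=> i; rewrite -ltnNge => /v0 ->; rewrite normr0.
by apply: ler_sum.
Qed.

(** An arbitrary list of indices containing an initial segment is allowed, so that
the estimate applies to all rearrangements of the expansion. *)
Lemma norm_expansion u k (s : seq nat) (e : R) : uniq s ->
  (forall i, (i < k)%N -> i \in s) ->
  (forall A, fam F A -> \sum_(i <- A | (k <= i)%N) `|u i| <= e) ->
  `|u - \sum_(j <- s) u j *: unit_vec j| <= 2 * e.
Proof.
move=> us ks; apply: norm_le_tail => i; last first.
  by rewrite coefB coef_comb//; case: ifP; rewrite ?subrr ?normr0 ?subr0.
by move=> /ks si; rewrite coefB coef_comb// si subrr.
Qed.

Lemma expansion_cvg u (s : nat -> nat) : bijective s ->
  series ((fun n => u n *: unit_vec n) \o s) @ \oo --> u.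
Proof.
move=> sb; apply/cvgrPdist_le => e e0.
have [k uk] := tail_small u (divr_gt0 e0 (ltr0n _ 2)).
have [t st ts] := sb.
exists (\max_(i < k) t i).+1 => // n /= tn.
rewrite seriesEnat/= -(big_map s xpredT (fun j => u j *: unit_vec j)).
rewrite [e](_ : _ = 2 * (e / 2)); last by rewrite mulrC divfK.
apply: norm_expansion uk; first by rewrite map_inj_uniq ?iota_uniq//; exact: bij_inj.
move=> i ik; rewrite -(ts i); apply: map_f; rewrite mem_index_iota/=.
apply: leq_trans tn; rewrite ltnS.
exact: (leq_bigmax (F := fun i : 'I_k => t i) (Ordinal ik)).
Qed.

Lemma expansion_unique (a : nat -> R) u :
  series (fun n => a n *: unit_vec n) @ \oo --> u -> a = coef u.
Proof.
move=> au; apply/funext => i.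
apply/eqP; rewrite -subr_eq0 -normr_le0; apply/ler_addgt0Pl => e e0; rewrite addr0.
move/cvgrPdist_le/(_ e e0) : au => [N _ /(_ (maxn N i.+1) (leq_maxl _ _))/=].
apply: le_trans; rewrite distrC; apply: le_trans (coef_le_norm _ i).
rewrite coefB seriesEnat/= coef_comb ?iota_uniq// mem_index_iota/=.
by rewrite (leq_maxr N i.+1).
Qed.

Lemma unit_vec_basis : unconditional_basis unit_vec.
Proof.
have id_bij : bijective (@id nat) by exists id.
split=> [u|u a au s sb]; last first.
  by rewrite (expansion_unique au); apply/cvg_ex; exists u; exact: expansion_cvg.
exists (coef u); split; first exact: expansion_cvg id_bij.
by move=> a /expansion_unique.
Qed.

End UnitVectors.

(** * Finite-dimensional subspaces *)

Lemma finite_set_inj_in (V : choiceType) (J : finType) (f : V -> J) (A : set V) :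
  {in A &, injective f} -> finite_set A.
Proof.
move=> fI; have [->|/set0P[x0 _]] := eqVneq A set0; first exact: finite_set0.
apply: (@sub_finite_set _ _
  ((fun j => xget x0 [set x | A x /\ f x = j]) @` [set: J])); last first.
  exact/finite_image/finite_finset.
move=> x Ax; exists (f x) => //.
by case: xgetP => [y _ [Ay fy]|/(_ x)/not_andP[]//]; apply: fI; rewrite ?inE.
Qed.

(** A point of a polyhedron is extreme only if the constraints active at it
determine it: from two points with the same active constraints one may move a
little along the line joining them in both directions. *)
Lemma finite_extreme_points (R : realType) (V : lmodType R) (J : finType)
    (E : set V) (phi : J -> V -> R) :
  (forall a x y, E x -> E y -> E (a *: x + y)) ->
  (forall j a x y, phi j (a *: x + y) = a * phi j x + phi j y) ->
  finite_set (extreme_points [set x | E x /\ forall j, phi j x <= 1]).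
Proof.
move=> El phil.
apply: (@finite_set_inj_in V {set J} (fun x => [set j | phi j x == 1]%SET)).
move=> x y /set_mem[[Ex x1] xext] /set_mem[[Ey y1] _] xy.
have eq1 j : phi j x = 1 -> phi j y = 1.
  by move=> /eqP jx; apply/eqP; move/setP/(_ j) : xy; rewrite !inE jx => <-.
have Ed : E (y - x) by rewrite addrC -scaleN1r; exact: El.
have phid j : phi j (y - x) = phi j y - phi j x.
  by rewrite addrC -scaleN1r phil mulN1r addrC.
pose S := \sum_j `|phi j (y - x)| / (1 - phi j x).
have S0 : 0 <= S by apply: sumr_ge0 => j _; rewrite divr_ge0// subr_ge0.
pose t := (1 + S)^-1; have t0 : 0 < t by rewrite invr_gt0 ltr_pwDl.
have small j s : `|s| = t -> phi j (s *: (y - x) + x) <= 1.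
  move=> st; rewrite phil; have [jx|jx] := eqVneq (phi j x) 1.
    by rewrite phid (eq1 _ jx) jx subrr mulr0 add0r.
  have xj : 0 < 1 - phi j x by rewrite subr_gt0 lt_neqAle jx x1.
  rewrite -lerBrDr (le_trans (ler_norm _))// normrM st mulrC ler_pdivrMr ?ltr_pwDl//.
  rewrite -ler_pdivrMl// mulrC /S (bigD1 j)//= addrCA lerDl addr_ge0//.
  by apply: sumr_ge0 => k _; rewrite divr_ge0// subr_ge0.
have half : 0 < (2^-1 : R) < 1.
  by apply/andP; split; lra.
have tt : `|t| = t by rewrite gtr0_norm.
have xE : x = 2^-1 *: (t *: (y - x) + x) + (1 - 2^-1) *: ((- t) *: (y - x) + x).
  have -> : 1 - 2^-1 = 2^-1 :> R by rewrite {1}(splitr 1) mul1r addrK.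
  rewrite -scalerDr scaleNr addrACA subrr add0r scalerDr -scalerDl.
  by rewrite -[2^-1]mul1r -splitr scale1r.
have [||+ _] := xext _ _ _ _ _ half xE.
- by split=> [|j]; [exact: El|exact: small].
- by split=> [|j]; [exact: El|apply: small; rewrite normrN].
move=> /eqP; rewrite -subr_eq0 addrK scaler_eq0 (gt_eqF t0)/= subr_eq0.
by move=> /eqP ->.
Qed.

Section FiniteDimensional.
Variables (R : realType) (F : weighted_family R).
Local Notation X := (family_space F).

(** The matrix of the first k coordinates of the vectors v_j has constant rank,
hence constant kernel, once k is large; then these k coordinates of a vector of
the span determine it linearly. *)
Lemma bounded_coefficients n (v : 'I_n -> X) :
  exists2 D : R, 0 <= D & forall a : 'I_n -> R, exists b : 'I_n -> R,
    \sum_j a j *: v j = \sum_j b j *: v j /\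
    forall j, `|b j| <= D * `|\sum_j a j *: v j|.
Proof.
pose M k : 'M[R]_(n, k) := \matrix_(j, i) coef (v j) i.
have exr : exists r, `[< exists k, \rank (M k) = r >].
  by exists (\rank (M 0%N)); apply/asboolP; exists 0%N.
have ler r : `[< exists k, \rank (M k) = r >] -> (r <= n)%N.
  by move=> /asboolP[k <-]; exact: rank_leq_row.
have [_ /asboolP[k <-] kmax] := ex_maxnP exr ler.
have MuE l (u : 'rV[R]_n) i : (u *m M l) 0 i = coef (\sum_j u 0 j *: v j) i.
  by rewrite mxE coef_bigsum; apply: eq_bigr => j _; rewrite mxE coefZ.
have kerM l : (k <= l)%N -> (kermx (M k) <= kermx (M l))%MS.
  move=> kl.
  have sub : (kermx (M l) <= kermx (M k))%MS.
    apply/rV_subP => u /sub_kermxP uM; apply/sub_kermxP/rowP => i.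
    by rewrite MuE -(MuE _ _ (widen_ord kl i)) uM !mxE.
  rewrite -(mxrank_leqif_sup sub).2 eqn_leq (mxrank_leqif_sup sub).1 !mxrank_ker.
  by rewrite leq_sub2l// kmax//; apply/asboolP; exists l.
pose D := \sum_j \sum_i `|pinvmx (M k) i j|.
exists D => [|a]; first by rewrite /D sumr_ge0// => j _; rewrite sumr_ge0.
pose y := \sum_j a j *: v j.
pose ar : 'rV[R]_n := \row_j a j; pose u := ar *m M k.
have uE i : u 0 i = coef y i.
  by rewrite MuE; congr coef; apply: eq_bigr => j _; rewrite mxE.
pose b := u *m pinvmx (M k).
have abker : ((ar - b)%R <= kermx (M k))%MS.
  by apply/sub_kermxP; rewrite mulmxBl mulmxKpV ?subrr// submxMl.
exists (fun j => b 0 j); split=> [|j].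
  apply/eqP; rewrite -subr_eq0 -sumrB; apply/eqP/val_inj/funext => i.
  change (coef (\sum_j (a j *: v j - b 0 j *: v j)) i = 0).
  have /sub_kermxP abM := submx_trans abker (kerM _ (leq_maxl k i.+1)).
  have ik : (i < maxn k i.+1)%N by rewrite leq_maxr.
  rewrite (eq_bigr (fun j => (ar - b) 0 j *: v j)).
    by rewrite -(MuE _ _ (Ordinal ik)) abM mxE.
  by move=> j _; rewrite !mxE scalerBl.
rewrite -/y mxE (le_trans (ler_norm_sum _ _ _))//.
rewrite (@le_trans _ _ (\sum_i `|pinvmx (M k) i j| * `|y|))//.
  apply: ler_sum => i _; rewrite normrM uE mulrC ler_wpM2l// coef_le_norm//.
rewrite -mulr_suml ler_wpM2r// /D (bigD1 j)//= lerDl sumr_ge0// => l _.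
exact: sumr_ge0.
Qed.

(** The coefficients with respect to a finite spanning family are controlled by the
norm, so it suffices that the tails of the spanning vectors are small. *)
Lemma uniform_tails (E : set X) (e : R) : finite_dim_subspace E -> 0 < e ->
  exists k, forall y, E y -> forall A, fam F A ->
    \sum_(i <- A | (k <= i)%N) `|y i| <= e * `|y|.
Proof.
move=> [n [v ->]] e0; have [D D0 vD] := bounded_coefficients v.
have e1 : 0 < e / (n%:R * D + 1) by rewrite divr_gt0// ltr_wpDl// mulr_ge0.
pose kv j := projT1 (cid (tail_small (v j) e1)).
have kvP j A : fam F A -> \sum_(i <- A | (kv j <= i)%N) `|v j i| <= _ :=
  projT2 (cid (tail_small (v j) e1)) A.
exists (\max_j kv j)%N => _ [a ->] A FA; have [b [ab bD]] := vD a.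
set y := \sum_j _ in ab bD *.
apply: (@le_trans _ _ (\sum_j `|b j| * \sum_(i <- A | (kv j <= i)%N) `|v j i|)).
  rewrite (eq_bigr _ (fun j _ => mulr_sumr _ _ _ _)).
  under [leRHS]eq_bigr do rewrite big_mkcond.
  rewrite exchange_big/= big_mkcond/=; apply: ler_sum => i _.
  case: ifPn => [ki|_]; last first.
    by apply: sumr_ge0 => j _; case: ifP => // _; rewrite mulr_ge0.
  rewrite ab coef_bigsum (le_trans (ler_norm_sum _ _ _))//; apply: ler_sum => j _.
  rewrite coefZ normrM ifT//; apply: leq_trans ki; exact: leq_bigmax.
apply: (@le_trans _ _ (\sum_(j < n) D * `|y| * (e / (n%:R * D + 1)))).
  by apply: ler_sum => j _; rewrite ler_pM ?sumr_ge0// kvP.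
rewrite sumr_const card_ord -[leLHS]mulr_natl.
have c0 : 0 < n%:R * D + 1 by rewrite ltr_wpDl ?mulr_ge0.

rewrite [leLHS](_ : _ = n%:R * D / (n%:R * D + 1) * (e * `|y|)); last by ring.
rewrite ler_piMl ?mulr_ge0 ?(ltW e0)// ler_pdivrMr// mul1r lerDl//.
Qed.
End FiniteDimensional.

(** * Antichains on few levels *)

(** The tree T, with nodes numbered by the natural numbers.  [width m] is the
number of levels allowed to an antichain that meets level m; as in Schreier
families, it is finite for each set but unbounded over all sets. *)
Record leveled_order := LeveledOrder {
  lev : nat -> nat;
  anc : rel nat;
  width : nat -> nat;
  lev_finite : forall m, exists B, forall i, (lev i < m)%N -> (i < B)%N;
  anc_lev : forall i j, anc i j -> (lev i < lev j)%N;
  width_gt0 : forall m, (0 < width m)%N;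
  width_homo : {homo width : m n / (m <= n)%N} }.

Definition fset_of_ords B (S : {set 'I_B}) : {fset nat} := [fset val i | i in S]%fset.

Lemma sum_fset_of_ords (R : nmodType) B (S : {set 'I_B}) (h : nat -> R) :
  \sum_(i <- fset_of_ords S) h i = \sum_(i in S) h i.
Proof. by rewrite big_imfset/= ?big_enum// => i j _ _; exact: val_inj. Qed.

Lemma fset_of_ordsP B (S : {set 'I_B}) i :
  reflect (exists2 j, j \in S & i = val j) (i \in fset_of_ords S).
Proof. exact: imfsetP. Qed.

Section LeveledSpace.
Variables (R : realType) (T : leveled_order).
Implicit Types A : {fset nat}.

Definition nlev A := size (undup [seq lev T i | i <- A]).

Definition admissible A :=
  (forall i j, i \in A -> j \in A -> ~~ anc T i j) /\
  (forall i, i \in A -> (nlev A <= width T (lev T i))%N).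

Lemma admissible1 i : admissible [fset i]%fset.
Proof.
split=> [j k|j]; rewrite !inE.
  by move=> /eqP -> /eqP ->; apply/negP => /anc_lev; rewrite ltnn.
move=> _; apply: leq_trans (width_gt0 T _); apply: (@uniq_leq_size _ _ [:: lev T i]).
  exact: undup_uniq.
by move=> m; rewrite mem_undup => /mapP[k]; rewrite !inE => /eqP -> ->.
Qed.

Lemma nlev_sub A A' : {subset A' <= A} -> (nlev A' <= nlev A)%N.
Proof.
move=> sub; apply: uniq_leq_size; rewrite ?undup_uniq// => m.
by rewrite !mem_undup => /mapP[i /sub iA ->]; apply: map_f.
Qed.

Lemma admissible_sub A A' : {subset A' <= A} -> admissible A -> admissible A'.
Proof.
move=> sub [Aanc Awd]; split=> [i j /sub iA /sub jA|i /sub iA]; first exact: Aanc.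
exact: leq_trans (nlev_sub sub) (Awd i iA).
Qed.

(** Fewer levels weigh more: a set gains by being cut off. *)
Definition level_wt A : R := 1 + (nlev A).+1%:R^-1.

Lemma level_wt_ge1 A : 1 <= level_wt A.
Proof. by rewrite lerDl invr_ge0. Qed.

Lemma level_wt_le2 A : level_wt A <= 2.
Proof.
rewrite -[2]/(1 + 1) lerD2l invf_le1 ?ltr0n//.
by rewrite (ler_nat R 1).
Qed.

Definition level_family : weighted_family R :=
  WeightedFamily admissible1 level_wt_ge1 level_wt_le2.

Local Notation X := (family_space level_family).
Local Notation lsum := (wsum level_family).

Lemma level_wt_gap A A' r : (nlev A' < nlev A <= r)%N ->
  level_wt A + (r.+1%:R * r.+1%:R)^-1 <= level_wt A'.
Proof.
move=> /andP[lt le]; rewrite -addrA lerD2l.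
have h0 : (0 < nlev A)%N by apply: leq_ltn_trans lt.
apply: (@le_trans _ _ (nlev A)%:R^-1); last first.
  by rewrite lef_pV2 ?posrE ?ltr0n// ler_nat.
apply: (@le_trans _ _ ((nlev A).+1%:R^-1 + ((nlev A)%:R * (nlev A).+1%:R)^-1)).
  rewrite lerD2l lef_pV2 ?posrE ?mulr_gt0 ?ltr0n//.
  by rewrite ler_pM// ler_nat// (leq_trans le).
rewrite -natr1; set h := (nlev A)%:R.
have {}h0 : h != 0 :> R by rewrite pnatr_eq0 -lt0n.
have h1 : h + 1 != 0 :> R by rewrite natr1 pnatr_eq0.
by rewrite le_eqVlt; apply/orP; left; apply/eqP; field; rewrite h0 h1.
Qed.

Lemma max_lev_lt k i : (i < k)%N -> (lev T i < (\max_(j < k) lev T j).+1)%N.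
Proof.
by move=> ik; rewrite ltnS (leq_bigmax (F := fun j : 'I_k => lev T j) (Ordinal ik)).
Qed.

(** On the unit sphere of a finite-dimensional subspace the far coordinates are
uniformly negligible.  A set carrying a large sum therefore meets an early
level, which bounds its number of levels, and cutting off its late levels gains
more through the weight than it loses in the sum. *)
Lemma finitely_many_sets (E : set X) : finite_dim_subspace E ->
  exists B, forall y, E y ->
    (forall A, admissible A -> (forall i, i \in A -> (i < B)%N) -> lsum A y <= 1) ->
    `|y| <= 1.
Proof.
move=> Efin.
have e8 : 0 < 8^-1 :> R by rewrite invr_gt0.
have [k0 k0P] := uniform_tails Efin e8.
pose r := width T (\max_(j < k0) lev T j).+1.
pose g : R := (r.+1%:R * r.+1%:R)^-1.
have g0 : 0 < g by rewrite invr_gt0 mulr_gt0 ?ltr0n.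
have g1 : g <= 1 by rewrite invf_le1 ?mulr_gt0 ?ltr0n// -natrM (ler_nat R 1).
have [k1 k1P] := uniform_tails Efin (divr_gt0 g0 (ltr0n R 16)).
set m := (\max_(j < k1) lev T j).+1.
have [B BP] := lev_finite T m; exists B => y Ey small.
rewrite leNgt; apply/negP => y1.
have /family_norm_gt[A Aadm] : Num.max 1 (`|y| / 2) < family_norm y.
  rewrite -norm_family gt_max y1 ltr_pdivrMr//.
  by rewrite ltr_pMr ?ltr1n// (lt_trans ltr01).
rewrite gt_max => /andP[A1 A2].
pose A' := [fset i in A | (lev T i < m)%N]%fset.
have subA : {subset A' <= A} by move=> i; rewrite !inE => /andP[].
suff : lsum A y <= lsum A' y.
  apply/negP; rewrite -ltNge; apply: le_lt_trans A1; apply: small.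
    exact: admissible_sub Aadm.
  by move=> i; rewrite !inE => /andP[_ /BP].
have [[i0 i0A i0m]|none] := pselect (exists2 i, i \in A & (m <= lev T i)%N); last first.
  suff -> : A' = A by [].
  apply/fsetP => i; rewrite !inE; case iA: (i \in A) => //=.
  by rewrite ltnNge; apply/negP => mi; apply: none; exists i.
have ltA : (nlev A' < nlev A)%N.
  rewrite /nlev; set L := undup [seq lev T i | i <- A].
  have i0L : lev T i0 \in L by rewrite mem_undup map_f.
  rewrite (perm_size (perm_to_rem i0L)) ltnS; apply: uniq_leq_size.
    exact: undup_uniq.
  move=> l; rewrite mem_undup => /mapP[i]; rewrite !inE => /andP[iA im ->].
  rewrite mem_rem_uniq ?undup_uniq// !inE mem_undup map_f// andbT.
  by apply: contraTneq im => ->; rewrite -leqNgt.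
have v0 : 0 < `|y| by rewrite (lt_trans ltr01).
have S4 : `|y| / 4 < \sum_(i <- A) `|y i|.
  by have := lt_le_trans A2 (wsum_le_sum level_family A y); lra.
have rA : (nlev A <= r)%N.
  have [[j jA jk]|none] := pselect (exists2 j, j \in A & (j < k0)%N).
    apply: leq_trans (Aadm.2 j jA) _; apply: width_homo; exact/ltnW/max_lev_lt.
  have := k0P y Ey A Aadm; rewrite -big_filter (_ : [seq i <- A | (k0 <= i)%N] = A); first by lra.
  apply/all_filterP/allP => j jA /=; rewrite leqNgt; apply/negP => jk.
  by apply: none; exists j.
have gap := level_wt_gap (introT andP (conj ltA rA)); rewrite -/g in gap.
have S'S : \sum_(i <- A) `|y i| <= \sum_(i <- A') `|y i| + g / 16 * `|y|.
  rewrite (bigID (fun i => (lev T i < m)%N))/= lerD//.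
    by apply: ler_sum_subset; rewrite ?fset_uniq// => i iA im; rewrite !inE iA im.
  apply: le_trans (k1P y Ey A Aadm); apply: ler_sum_subset; rewrite ?fset_uniq//.
  move=> i iA im; rewrite iA leqNgt; apply: contra im; exact: max_lev_lt.
rewrite /wsum/=.
set S := \sum_(i <- A) _ in S4 S'S *; set S' := \sum_(i <- A') _ in S'S *.
have c1 := level_wt_ge1 A; have c2 := level_wt_le2 A.
have S'0 : 0 <= S' by rewrite sumr_ge0.
apply: (@le_trans _ _ ((level_wt A + g) * S')); last by rewrite ler_wpM2r.
apply: (@le_trans _ _ ((level_wt A + g) * (S - g / 16 * `|y|))); last first.
  apply: ler_wpM2l; last by rewrite lerBlDr.
  by rewrite addr_ge0 ?(ltW g0)// (le_trans ler01).
rewrite -subr_ge0 [leRHS](_ : _ = g * (S - (level_wt A + g) * `|y| / 16)); last by ring.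
apply: mulr_ge0; first exact: ltW.
have : (level_wt A + g) * `|y| <= 3 * `|y| by rewrite ler_wpM2r//; lra.
by lra.
Qed.

(** The space is polyhedral: on a finite-dimensional subspace its norm is the
maximum of finitely many signed coordinate sums. *)
Theorem level_space_polyhedral : polyhedral X.
Proof.
move=> E Efin; have [B BP] := finitely_many_sets Efin.
pose sg (s : {set 'I_B}) i : R := (-1) ^+ (i \in s).
pose phi (j : {set 'I_B} * {set 'I_B}) (x : X) : R :=
  if `[< admissible (fset_of_ords j.1) >] then
    level_wt (fset_of_ords j.1) * \sum_(i in j.1) sg j.2 i * x i else 0.
rewrite (_ : [set x | _] = [set x | E x /\ forall j, phi j x <= 1]).
  apply: finite_extreme_points => [a x y|j a x y].
    case: Efin => n [v ->] [b ->] [c ->]; exists (fun i => a * b i + c i).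
    rewrite scaler_sumr -big_split/=; apply: eq_bigr => i _.
    by rewrite scalerDl scalerA.
  rewrite /phi; case: asboolP => _; last by rewrite mulr0 addr0.
  rewrite mulrCA -mulrDr; congr (_ * _); rewrite mulr_sumr -big_split/=.
  by apply: eq_bigr => i _; rewrite coefD coefZ mulrDr mulrCA.
apply/seteqP; split=> x [Ex x1]; split=> //.
  move=> [S s]; rewrite /phi/=; case: asboolP => [adm|_]; last exact: ler01.
  apply: le_trans x1; apply: le_trans (@wsum_le _ level_family x _ adm).
  rewrite /wsum/= sum_fset_of_ords.
  rewrite ler_wpM2l ?(le_trans ler01 (level_wt_ge1 _))//; apply: ler_sum => i _.
  by rewrite (le_trans (ler_norm _))// normrM normrX normrN1 expr1n mul1r.
apply: BP => // A adm AB.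
pose S : {set 'I_B} := [set i | val i \in A]%SET.
have SA : fset_of_ords S = A.
  apply/fsetP => i; apply/fset_of_ordsP/idP => [[j]|iA]; first by rewrite inE => jA ->.
  by exists (Ordinal (AB i iA)) => //=; rewrite inE.
have := x1 (S, [set i : 'I_B | coef x i < 0]%SET); rewrite /phi/= SA.
case: asboolP => // _; congr (_ * _ <= _).
rewrite -SA sum_fset_of_ords; apply: eq_bigr => i _; rewrite /sg inE.
have [xi|xi] := ltrP (coef x i) 0; last by rewrite expr0 mul1r ger0_norm.
by rewrite expr1 mulN1r ltr0_norm.
Qed.

End LeveledSpace.

(** * Sampling antichains *)

Lemma bernoulli_le (R : realFieldType) (d : R) r : 0 <= d <= 1 ->
  1 - r%:R * d <= (1 - d) ^+ r.
Proof.
move=> /andP[d0 d1]; elim: r => [|r IH]; first by rewrite mul0r subr0 expr0.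
have d1' : 0 <= 1 - d by rewrite subr_ge0.
rewrite exprS -natr1; apply: le_trans (ler_wpM2l d1' IH).
by have := ler0n R r; move: (r%:R) => c c0; nra.
Qed.

(** Draw r + 1 levels independently with law nu, and keep the elements of C on
a drawn level none of whose predecessors in C is on a drawn level.  They form
an antichain.  As the levels of the predecessors of t have small probability,
t is kept with probability at least half of (r + 1) nu (lv t). *)
Lemma sampled_antichain (R : realType) l n r (C : {set 'I_l}) (x : 'I_l -> R)
    (nu : 'I_n -> R) (lv : 'I_l -> 'I_n) (e : rel 'I_l) (M d : R) :
  (forall i, 0 <= x i) -> (forall m, 0 <= nu m) -> \sum_m nu m = 1 ->
  (forall s t, e s t -> lv s != lv t) ->
  (forall t, t \in C -> \sum_(m | [exists s in C, ((s == t) || e s t) && (lv s == m)])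
     nu m <= d) -> r%:R * d <= 2^-1 ->
  (forall A : {set 'I_l}, A \subset C ->
     (forall s t, s \in A -> t \in A -> ~~ e s t) -> (#|lv @: A| <= r.+1)%N ->
     \sum_(t in A) x t <= M) ->
  r.+1%:R * \sum_(t in C) nu (lv t) * x t <= 2 * M.
Proof.
move=> x0 nu0 nu1 elv Ld rd CM.
pose L t := [set m | [exists s in C, ((s == t) || e s t) && (lv s == m)]]%SET.
pose G := {ffun 'I_r.+1 -> 'I_n}.
pose kept (g : G) := [set t in C | (lv t \in codom g) &&
  [forall s in C, e s t ==> (lv s \notin codom g)]]%SET.
pose P (g : G) := \prod_k nu (g k).
have P0 g : 0 <= P g by apply: prodr_ge0.
have P1 : \sum_g P g = 1.
  by rewrite -(bigA_distr_bigA (fun _ => nu)) big1.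
have massM (g : G) : \sum_(t in kept g) x t <= M.
  apply: CM; first by apply/fintype.subsetP => t; rewrite inE => /andP[].
    move=> s t; rewrite !inE => /and3P[sC sg _] /and3P[tC tg /forallP/(_ s)].
    by rewrite sC/=; case: (e s t) => //; rewrite sg.
  apply: (@leq_trans #|codom g|); last by rewrite (leq_trans (card_size _))// size_codom card_ord.
  apply: subset_leq_card; apply/fintype.subsetP => m /imsetP[t].
  by rewrite inE => /and3P[_ tg _ ->].
(* A lower bound for the probability that t is kept: the events that the k-th
   draw is the level of t and all other draws avoid L t are disjoint. *)
have tP t : t \in C ->
    r.+1%:R * nu (lv t) / 2 <= \sum_g P g * (t \in kept g)%:R.
  move=> tC.
  pose ok (k j : 'I_r.+1) (m : 'I_n) : bool := if j == k then m == lv t else m \notin L t.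
  have tL : lv t \in L t by rewrite inE; apply/existsP; exists t; rewrite tC !eqxx.
  apply: (@le_trans _ _ (\sum_(g : G) \sum_k \prod_j (nu (g j) * (ok k j (g j))%:R) : R)).
    rewrite exchange_big/=.
    rewrite (eq_bigr (fun k => nu (lv t) * (1 - \sum_(m in L t) nu m) ^+ r)); last first.
      move=> k _; rewrite -(bigA_distr_bigA (fun j m => nu m * (ok k j m)%:R)).
      rewrite (bigD1 k)//=; congr (_ * _).
        rewrite (bigD1 (lv t))//= /ok !eqxx/= mulr1 big1 ?addr0// => m mt.
        by rewrite (negPf mt) mulr0.
      rewrite (eq_bigr (fun _ => 1 - \sum_(m in L t) nu m)).
        by rewrite prodr_const cardC1 card_ord.
      move=> j jk; rewrite -[X in X - _]nu1 (bigID (mem (L t)))/=.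
      rewrite big1 => [|m mL]; last by rewrite /ok (negPf jk) (_ : m \in L t) ?mulr0.
      rewrite add0r [in RHS](bigID (mem (L t)))/= addrAC subrr add0r.
      by apply: eq_bigr => m mL; rewrite /ok (negPf jk) (_ : m \notin L t) ?mulr1.
    rewrite sumr_const card_ord -[leRHS]mulr_natl -mulrA ler_wpM2l// ler_wpM2l//.
    have Lt := Ld t tC.
    have L0 : 0 <= \sum_(m in L t) nu m by apply: sumr_ge0.
    have {}Lt : \sum_(m in L t) nu m <= d.
      by apply: le_trans Lt; rewrite le_eqVlt; apply/orP; left; apply/eqP/eq_bigl => m; rewrite inE.
    have L1 : \sum_(m in L t) nu m <= 1.
      by rewrite -[leRHS]nu1 [leRHS](bigID (mem (L t)))/= lerDl sumr_ge0.
    apply: le_trans (bernoulli_le r (introT andP (conj L0 L1))).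
    have : r%:R * (\sum_(m in L t) nu m) <= r%:R * d by rewrite ler_wpM2l.
    by move: rd; lra.
  apply: ler_sum => g _.
  rewrite (eq_bigr (fun k => P g * \prod_j (ok k j (g j))%:R)); last first.
    by move=> k _; rewrite big_split.
  rewrite -mulr_sumr ler_wpM2l//.
  have prod_ok k : \prod_j (ok k j (g j))%:R = [forall j, ok k j (g j)]%:R :> R.
    case: forallP => [h|]; first by rewrite big1// => j _; rewrite h.
    by move=> /forallP; rewrite negb_forall => /existsP[j jN]; rewrite (bigD1 j)//= (negPf jN) mul0r.
  rewrite (eq_bigr _ (fun k _ => prod_ok k)).
  have [k okk|none] := pickP (fun k => [forall j, ok k j (g j)]); last first.
    by rewrite big1 ?ler0n// => k _; rewrite none.
  move/forallP in okk.
  have gk : g k = lv t by have := okk k; rewrite /ok eqxx => /eqP.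
  have gj j : j != k -> g j \notin L t by have := okk j; rewrite /ok; case: eqP.
  rewrite (bigD1 k)//= big1 => [|j jk]; last first.
    case: forallP => // /(_ j); rewrite /ok eqxx => /eqP gjt.
    by have := gj j jk; rewrite gjt tL.
  rewrite addr0 (_ : t \in kept g) ?ler_nat ?leq_b1// inE tC -gk codom_f/=.
  apply/forallP => s; apply/implyP => sC; apply/implyP => est.
  apply/negP => /codomP[j sj]; have [jk|/gj] := eqVneq j k.
    by move: (elv _ _ est); rewrite sj jk gk eqxx.
  by rewrite -sj inE => /negP; apply; apply/existsP; exists s; rewrite sC est orbT eqxx.
have : \sum_(t in C) (r.+1%:R * nu (lv t) / 2) * x t <= M.
  apply: (@le_trans _ _ (\sum_g P g * \sum_(t in kept g) x t)).
    rewrite (eq_bigr _ (fun g _ => mulr_sumr _ _ _ _)).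
    under [leRHS]eq_bigr do rewrite big_mkcond.
    rewrite exchange_big/= [leLHS]big_mkcond; apply: ler_sum => t _.
    case: ifPn => [tC|_]; last by apply: sumr_ge0 => g _; case: ifP => // _; rewrite mulr_ge0.
    apply: le_trans (ler_wpM2r (x0 t) (tP t tC)) _; rewrite mulr_suml.
    by apply: ler_sum => g _; case: ifP; rewrite ?mulr1 ?mulr0 ?mul0r.
  rewrite -[leRHS]mul1r -P1 mulr_suml; apply: ler_sum => g _.
  by rewrite ler_wpM2l.
rewrite (eq_bigr (fun t => r.+1%:R / 2 * (nu (lv t) * x t))); last first.
  by move=> t _; ring.
by rewrite -mulr_sumr; lra.
Qed.

(** * The p-dual of a solid set *)

Section UpperDual.
Variables (R : realType) (p : R) (SB : (nat -> R) -> Prop).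
Hypothesis p1 : 1 < p.

(** The unit ball of the least norm that dominates the norm dual to SB and satisfies
a lower estimate for the conjugate exponent with constant one.  A
disjointly supported family in SB is encoded by a colouring chi of the
coordinates, the member of colour j being u j restricted to that colour. *)
Definition upper_dual (a : nat -> R) : Prop :=
  forall n k (chi : nat -> 'I_k) (u : 'I_k -> nat -> R) (la : 'I_k -> R),
    (forall j, SB (u j)) -> (forall j, 0 <= la j) -> \sum_j la j `^ p <= 1 ->
    \sum_(m < n) la (chi m) * `|a m * u (chi m) m| <= 1.

Lemma upper_dual_norm a : upper_dual a -> upper_dual (fun m => `|a m|).
Proof.
move=> aD n k chi u la uS la0 la1; apply: le_trans (aD n k chi u la uS la0 la1).
by apply: ler_sum => m _; rewrite !normrM normr_id.
Qed.

Lemma upper_dual0 : upper_dual (fun=> 0).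
Proof. by move=> n k chi u la _ _ _; rewrite big1// => m _; rewrite mul0r normr0 mulr0. Qed.

Lemma upper_dual_le1 a b n : upper_dual a -> SB b -> \sum_(m < n) `|a m * b m| <= 1.
Proof.
move=> aD bS; have := aD n 1%N (fun=> ord0) (fun=> b) (fun=> 1) (fun=> bS) (fun=> ler01).
rewrite big_ord1 powR1 => /(_ (lexx _)); apply: le_trans.
by apply: ler_sum => m _; rewrite mul1r.
Qed.

Lemma upper_dual_entry a b m : upper_dual a -> SB b -> `|a m * b m| <= 1.
Proof.
move=> aD /(upper_dual_le1 m.+1 aD); rewrite big_ord_recr/=; apply: le_trans.
by rewrite lerDr sumr_ge0.
Qed.

(** Pairing a with la w + s b, where w is supported off L and b on L, shows that
the restriction of a off L is smaller by the factor (1 - s beta) / la, where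
beta is the pairing of a with b on L. *)
Lemma upper_dual_restrict a b n (L : pred nat) (s la be : R) :
  upper_dual a -> SB b -> (forall m, L m -> (m < n)%N) ->
  0 <= s -> 0 <= la -> s `^ p + la `^ p <= 1 ->
  be = \sum_(m < n | L m) `|a m * b m| -> s * be < 1 ->
  upper_dual (fun m => if L m then 0 else la / (1 - s * be) * a m).
Proof.
move=> aD bS Ln s0 la0 sla beE sbe n' k chi u mu uS mu0 mu1.
have c0 : 0 < 1 - s * be by rewrite subr_gt0.
have lc0 : 0 <= la / (1 - s * be) by rewrite divr_ge0// ltW.
pose chi' m : 'I_k.+1 := if L m then ord0 else lift ord0 (chi m).
pose u' j := if unlift ord0 j is Some i then u i else b.
pose mu' j := if unlift ord0 j is Some i then la * mu i else s.
have := aD (maxn n n') k.+1 chi' u' mu'.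
have u'S j : SB (u' j) by rewrite /u'; case: unliftP.
have mu'0 j : 0 <= mu' j by rewrite /mu'; case: unliftP => // i _; rewrite mulr_ge0.
have mu'1 : \sum_j mu' j `^ p <= 1.
  rewrite big_ord_recl /mu' unlift_none; apply: le_trans sla; rewrite lerD2l.
  rewrite (eq_bigr (fun j => la `^ p * mu j `^ p)) => [|j _].
    by rewrite -mulr_sumr ler_piMr// powR_ge0.
  by rewrite liftK powRM.
move=> /(_ u'S mu'0 mu'1) main.
have {main} main : s * be + \sum_(m < maxn n n' | ~~ L m) la * (mu (chi m) * `|a m * u (chi m) m|) <= 1.
  apply: le_trans main; rewrite [leRHS](bigID (fun m : 'I_(maxn n n') => L m))/=.
  rewrite lerD//.
    rewrite beE mulr_sumr -(big_mkord L (fun m => s * `|a m * b m|)).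
    rewrite -(big_mkord L (fun m => mu' (chi' m) * `|a m * u' (chi' m) m|)).
    rewrite (@le_trans _ _ (\sum_(0 <= m < n | L m) mu' (chi' m) * `|a m * u' (chi' m) m|))//.
      by apply: ler_sum => m Lm; rewrite /chi' Lm /mu' /u' unlift_none.
    apply: ler_sum_subset => [m||m _ Lm]; rewrite ?mulr_ge0 ?iota_uniq//.
    by rewrite mem_index_iota Lm/= leq_max Ln.
  by apply: ler_sum => m Lm; rewrite /chi' (negPf Lm) /mu' /u' liftK mulrA.
rewrite (@le_trans _ _ (\sum_(m < n' | ~~ L m)
    (la * (mu (chi m) * `|a m * u (chi m) m|)) / (1 - s * be)))//.
  rewrite [leRHS]big_mkcond; apply: ler_sum => m _; case: ifP => /= [Lm|Lm].
    by rewrite mul0r normr0 mulr0.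
  rewrite -[la / _ * a m * _]mulrA normrM (ger0_norm lc0).
  by rewrite le_eqVlt; apply/orP; left; apply/eqP; ring.
rewrite -mulr_suml ler_pdivrMr// mul1r lerBrDl; apply: le_trans main; rewrite lerD2l.
rewrite -(big_mkord (fun m => ~~ L m) (fun m => la * (mu (chi m) * `|a m * u (chi m) m|))).
rewrite -[leRHS](big_mkord (fun m => ~~ L m) (fun m => la * (mu (chi m) * `|a m * u (chi m) m|))).
apply: ler_sum_subset => [m||m]; rewrite ?mulr_ge0 ?iota_uniq//.
by rewrite !mem_index_iota => /andP[_ mn] ->; rewrite leq_max mn orbT.
Qed.

(** If a nearly maximises the pairing with y and nu_m = a_m y_m / (a.y), then a
set L on which a |b| exceeds nu by a factor kappa has small nu-measure:
otherwise moving a little from y to b on L would increase the pairing. *)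
Lemma small_measure (a b y : nat -> R) n (L : pred nat) (s kappa e S q : R) :
  (forall a', upper_dual a' -> (forall m, 0 <= a' m) -> \sum_(m < n) a' m * y m <= S) ->
  upper_dual a -> (forall m, 0 <= a m) -> (forall m, 0 <= y m) ->
  SB b -> (forall m, L m -> (m < n)%N) ->
  0 < S -> 0 <= e <= 1 -> (1 - e) * S <= \sum_(m < n) a m * y m ->
  0 < \sum_(m < n) a m * y m ->
  0 <= s < 1 -> s * kappa = 2 ->
  q = (\sum_(m < n | L m) a m * y m) / (\sum_(m < n) a m * y m) ->
  (forall m, L m -> kappa * (a m * y m / (\sum_(m < n) a m * y m)) <= `|a m * b m|) ->
  q <= s `^ p + e.
Proof.
set S' := \sum_(m < n) _.
move=> SP aD a0 y0 bS Ln S0 /andP[e0 e1] S'S S'0 /andP[s0 s1] sk qE Lb.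
have p0 : 0 < p by rewrite (lt_trans ltr01).
have sp0 := powR_ge0 s p.
have one_powR (r : R) : 1 `^ r = 1 by rewrite powR1.
have sp1 : s `^ p <= 1.
  by rewrite -[leRHS](one_powR p); apply: ge0_ler_powR; rewrite ?nnegrE//; exact: ltW.
pose la := (1 - s `^ p) `^ p^-1.
have la0 : 0 <= la by exact: powR_ge0.
have lap : la `^ p = 1 - s `^ p.
  by rewrite -powRrM mulVf ?gt_eqF// powRr1// subr_ge0.
(* la is the largest factor that may accompany s in a p-convex combination. *)
have lal : 1 - s `^ p <= la.
  have [->|ne] := eqVneq (1 - s `^ p) 0; first exact: la0.
  apply: ger1_powR; last by rewrite invf_le1 ?ltW.
  by rewrite lt_neqAle eq_sym ne subr_ge0 sp1/= gerBl.
have la1 : la <= 1.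
  by rewrite -[leRHS](one_powR p^-1); apply: ge0_ler_powR; rewrite ?nnegrE ?invr_ge0 ?(ltW p0)// ?subr_ge0// gerBl.
have [be beE] : exists be, be = \sum_(m < n | L m) `|a m * b m| by exists (\sum_(m < n | L m) `|a m * b m|).
have be1 : be <= 1.
  rewrite beE; apply: le_trans (upper_dual_le1 n aD bS); rewrite [leRHS](bigID (fun m : 'I_n => L m))/=.
  by rewrite lerDl sumr_ge0.
have be0 : 0 <= be by rewrite beE; exact: sumr_ge0.
have sbe : s * be < 1 by apply: le_lt_trans s1; rewrite ler_piMr.
have c0 : 0 < 1 - s * be by rewrite subr_gt0.
have kq : kappa * q <= be.
  rewrite qE beE mulr_suml mulr_sumr; apply: ler_sum => m Lm; exact: Lb.
have slap : s `^ p + la `^ p <= 1 by rewrite lap addrC subrK.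
have r0 m : 0 <= (if L m then 0 else la / (1 - s * be) * a m).
  by case: ifP => // _; rewrite mulr_ge0// divr_ge0// ltW.
have main := SP _ (upper_dual_restrict aD bS Ln s0 la0 slap beE sbe) r0.
have q0 : 0 <= q by rewrite qE divr_ge0 ?(ltW S'0)// sumr_ge0// => m _; rewrite mulr_ge0.
have rE : \sum_(m < n) (if L m then 0 else la / (1 - s * be) * a m) * y m =
    la / (1 - s * be) * (S' * (1 - q)).
  rewrite mulrBr mulr1 qE mulrCA mulfV ?gt_eqF// mulr1 /S'.
  rewrite [in RHS](bigID (fun m : 'I_n => L m))/= addrAC subrr add0r mulr_sumr.
  rewrite [RHS]big_mkcond; apply: eq_bigr => m _; case: ifP => //= Lm; by rewrite ?mul0r ?mulrA.
rewrite rE in main.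
have {}main : la * (S' * (1 - q)) <= S * (1 - s * be).
  by move: main; rewrite mulrAC ler_pdivrMr.
have sbeq : 2 * q <= s * be by rewrite -sk -mulrA ler_wpM2l.
have [q1|q1] := leP q 1; last first.
  have : s * be <= be by rewrite ler_piMl// ltW.
  lra.
have m1 : la * ((1 - e) * S * (1 - q)) <= S * (1 - 2 * q).
  apply: (@le_trans _ _ (la * (S' * (1 - q)))).
    by rewrite ler_wpM2l// ler_wpM2r// subr_ge0.
  by apply: (le_trans main); rewrite ler_wpM2l ?(ltW S0)// lerD2l lerN2.
have {}m1 : la * (1 - e) * (1 - q) <= 1 - 2 * q.
  by rewrite -(ler_pM2l S0) (le_trans _ m1)// le_eqVlt; apply/orP; left; apply/eqP; ring.
have le1 : la * (1 - e) <= 1 by rewrite mulr_ile1// ?subr_ge0// gerBl.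
have l2 : la * e <= e by rewrite ler_piMl.
have l3 := ler_wpM2r q0 le1; rewrite mul1r in l3.
by clear -m1 l2 l3 lal; lra.
Qed.

End UpperDual.

(** * The tree estimate *)

Lemma sum_arith_geometric (R : realFieldType) (r : R) n : 0 <= r < 1 ->
  \sum_(j < n) j.+1%:R * r ^+ j <= (1 - r) ^- 2.
Proof.
move=> /andP[r0 r1]; have c0 : 0 < 1 - r by rewrite subr_gt0.
suff /(_ n) E : forall n, (1 - r) ^+ 2 * \sum_(j < n) j.+1%:R * r ^+ j =
    1 - n.+1%:R * r ^+ n + n%:R * r ^+ n.+1.
  rewrite -[leRHS]mul1r ler_pdivlMr ?exprn_gt0// mulrC E -addrA gerDl.
  rewrite addrC subr_le0 exprS mulrCA (@le_trans _ _ (n%:R * r ^+ n))//.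
    by rewrite ler_piMl ?mulr_ge0 ?exprn_ge0// ltW.
  by rewrite ler_wpM2r ?exprn_ge0// ler_nat.
elim=> [|k IH]; first by rewrite big_ord0; ring.
rewrite big_ord_recr/= mulrDr IH exprS -!natr1 !exprS; ring.
Qed.

Section TreeEstimate.
Variables (R : realType) (p : R) (T : leveled_order).
Variables (SB : (nat -> R) -> Prop) (b : nat -> nat -> R).
Hypothesis p1 : 1 < p.
Hypothesis bS : forall i, SB (b i).
Hypothesis b_anc : forall s t, anc T s t -> b s (lev T s) = b t (lev T s).

Let h : R := 2 `^ p.
Let rho : R := 2 / h.

Hypothesis width_geometric :
  forall j m, (j <= m)%N -> (Num.truncn (h ^+ j / 4) < width T m)%N.

Let h2 : 2 < h.
Proof.
rewrite lt_neqAle le1r_powR ?ler1n ?(ltW p1)// andbT; apply/eqP => E.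
have ln2 : ln 2 != 0 :> R by rewrite gt_eqF// ln_gt0// ltr1n.
have : p * ln 2 = ln 2 by rewrite -ln_powR -/h -E.
move=> /eqP; rewrite -subr_eq0 -{2}[ln 2]mul1r -mulrBl mulf_eq0 (negPf ln2) orbF.
by rewrite subr_eq0 gt_eqF.
Qed.

Let h0 : 0 < h. Proof. by rewrite (lt_trans _ h2). Qed.
Let rho01 : 0 <= rho < 1.
Proof. by rewrite divr_ge0 ?(ltW h0)//= ltr_pdivrMr// mul1r. Qed.

Lemma half_powR j : (2^-1 ^+ j) `^ p = h ^- j.
Proof.
have half : 2^-1 `^ p = h^-1.
  apply: (mulIf (lt0r_neq0 h0)); rewrite mulVf ?gt_eqF// /h -powRM ?invr_ge0//.
  by rewrite mulVf ?powR1// pnatr_eq0.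
by rewrite -[2^-1 ^+ j]powR_mulrn ?invr_ge0// powRAC half powR_mulrn ?exprVn// invr_ge0 ltW.
Qed.

Section FixedVector.
Variables (l : nat) (x : nat -> R) (M : R).
Hypothesis xM : forall A, admissible T A -> (forall i, i \in A -> (i < l)%N) ->
  \sum_(i <- A) `|x i| <= M.

Let n := (\max_(i < l) lev T i).+1.
Let lv (i : 'I_l) : 'I_n := Ordinal (max_lev_lt T (ltn_ord i)).

Lemma antichain_sum_le (A : {set 'I_l}) :
  (forall s t, s \in A -> t \in A -> ~~ anc T s t) ->
  (forall i, i \in A -> (#|lv @: A| <= width T (lev T i))%N) ->
  \sum_(i in A) `|x i| <= M.
Proof.
move=> Aanc Awd; rewrite -(sum_fset_of_ords A (fun i => `|x i|)); apply: xM; last first.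
  by move=> i /fset_of_ordsP[j _ ->]; exact: ltn_ord.
split=> [i j /fset_of_ordsP[s sA ->] /fset_of_ordsP[t tA ->]|i]; first exact: Aanc.
move=> /fset_of_ordsP[t tA ->]; apply: leq_trans (Awd t tA).
rewrite cardE /nlev -[X in (_ <= X)%N](size_map val); apply: uniq_leq_size.
  exact: undup_uniq.
move=> m; rewrite mem_undup => /mapP[k /fset_of_ordsP[s sA ->] ->].
by apply/mapP; exists (lv s) => //; rewrite mem_enum; apply: imset_f.
Qed.

Lemma bound_ge0 : 0 <= M.
Proof.
have := antichain_sum_le (A := finset.set0); rewrite big_set0; apply.
  by move=> s t; rewrite inE.
by move=> i; rewrite inE.
Qed.

Lemma level_sum_le m : \sum_(i < l | lev T i == m) `|x i| <= M.
Proof.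
rewrite (eq_bigl (fun i => i \in [set i : 'I_l | lev T i == m]%SET)); last by move=> i; rewrite inE.
apply: antichain_sum_le => [s t|i].
  by rewrite !inE => /eqP sm /eqP tm; apply/negP => /anc_lev; rewrite sm tm ltnn.
rewrite inE => /eqP im; apply: leq_trans (width_gt0 T _).
have [mn|mn] := ltnP m n; last by have := max_lev_lt T (ltn_ord i); rewrite im ltnNge mn.
rewrite -(cards1 (Ordinal mn)); apply: subset_leq_card; apply/fintype.subsetP => k.
by move=> /imsetP[s]; rewrite !inE => /eqP sm ->; apply/eqP/val_inj.
Qed.

(** The m-th coefficient of the image of x, with all signs made positive. *)
Definition level_mass m : R := \sum_(i < l | lev T i == m) `|b i m| * `|x i|.

Lemma level_mass_ge0 m : 0 <= level_mass m.
Proof. by apply: sumr_ge0 => i _; rewrite mulr_ge0. Qed.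

Lemma pairing_levels (a : nat -> R) : \sum_(m < n) a m * level_mass m =
  \sum_(i < l) a (lev T i) * `|b i (lev T i)| * `|x i|.
Proof.
rewrite [RHS](partition_big lv xpredT)//=; apply: eq_bigr => m _.
rewrite mulr_sumr; apply: eq_big => [i|i /eqP <-]; last by rewrite mulrA.
by rewrite -val_eqE.
Qed.

Section NearMaximizer.
Variables (a : nat -> R) (e S : R).
Local Notation y := level_mass.
Hypothesis SP : forall a', upper_dual p SB a' -> (forall m, 0 <= a' m) ->
  \sum_(m < n) a' m * y m <= S.
Hypotheses (aD : upper_dual p SB a) (a0 : forall m, 0 <= a m).
Hypotheses (S0 : 0 < S) (e01 : 0 <= e <= 1).
Let S' := \sum_(m < n) a m * y m.
Hypotheses (S'S : (1 - e) * S <= S') (S'0 : 0 < S').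

Let nu m := a m * y m / S'.
Let w i := a (lev T i) * `|b i (lev T i)|.

Let nu0 m : 0 <= nu m.
Proof. by rewrite divr_ge0 ?mulr_ge0 ?level_mass_ge0 ?(ltW S'0). Qed.

Let w0 i : 0 <= w i. Proof. by rewrite mulr_ge0. Qed.

Lemma nu_sum1 : \sum_(m < n) nu m = 1.
Proof. by rewrite -mulr_suml mulfV ?gt_eqF. Qed.

(** The classes C below consist of nodes i whose weight w i exceeds nu by a factor
2^(j+1).  The sequence attached to t has the same entries as its predecessors
at their levels, so small_measure applies to it with s = 2^(-j). *)
Lemma class_measure j (C : {set 'I_l}) (t : 'I_l) : (0 < j)%N -> e <= h ^- j ->
  (forall i, i \in C -> 2 ^+ j.+1 * nu (lev T i) <= w i) -> t \in C ->
  \sum_(m < n | [exists s in C, ((s == t) || anc T s t) && (lv s == m)]) nu m <=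
    2 / h ^+ j.
Proof.
move=> j0 eh Cw tC.
pose L m := [exists s in C, ((s == t) || anc T s t) && (lev T s == m)].
have Ln m : L m -> (m < n)%N.
  by move=> /existsP[s /and3P[_ _ /eqP <-]]; exact: max_lev_lt.
rewrite (eq_bigl (fun m : 'I_n => L m)); last first.
  by move=> m; apply: eq_existsb => s; rewrite -val_eqE.
apply: (@le_trans _ _ ((2^-1 ^+ j) `^ p + e)); last first.
  by rewrite half_powR mulrC mulr_natr mulr2n lerD2l.
apply: (small_measure p1 SP aD a0 level_mass_ge0 (bS t) Ln S0 e01 S'S S'0 _ (kappa := 2 ^+ j.+1)).
- rewrite exprn_ge0 ?invr_ge0//= exprn_ilt1 ?invr_ge0 ?invf_lt1 ?ltr1n//.
  by rewrite -lt0n.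
- by rewrite exprVn exprS mulrCA mulVf ?mulr1// expf_neq0// pnatr_eq0.
- by rewrite mulr_suml.
move=> m /existsP[s /and3P[sC st /eqP <-]]; apply: (le_trans (Cw s sC)).
rewrite normrM (ger0_norm (a0 _)) /w.
by case/orP: st => [/eqP ->|/b_anc ->].
Qed.

(** From level j on, enough levels are allowed for sampling about h^j / 4 of them,
which is the number of draws permitted by class_measure. *)
Lemma class_late j (C : {set 'I_l}) : (0 < j)%N -> e <= h ^- j ->
  (forall i, i \in C -> 2 ^+ j.+1 * nu (lev T i) <= w i) ->
  (forall i, i \in C -> (j <= lev T i)%N) ->
  \sum_(i in C) nu (lev T i) * `|x i| <= 8 / h ^+ j * M.
Proof.
move=> j0 eh Cw Cj; have hj : 0 < h ^+ j by rewrite exprn_gt0.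
set r := Num.truncn (h ^+ j / 4).
have main : r.+1%:R * (\sum_(i in C) nu (lv i) * `|x i|) <= 2 * M.
  apply: (sampled_antichain (e := fun s t => anc T s t) _ _ nu_sum1 _ (d := 2 / h ^+ j)) => //.
  - by move=> s t /anc_lev; rewrite -val_eqE/= ltn_neqAle => /andP[].
  - by move=> t; exact: class_measure.
  - rewrite mulrA ler_pdivrMr//; have := truncn_le (h ^+ j / 4).
    by rewrite divr_ge0 ?(ltW hj)// -/r; lra.
  - move=> A /fintype.subsetP AC Aanc Ar; apply: antichain_sum_le => // i iA.
    by apply: leq_trans Ar _; exact/width_geometric/Cj/AC.
rewrite mulrAC ler_pdivlMr//.
have rh : h ^+ j / 4 <= r.+1%:R by rewrite ltW// truncnS_gt.
have N0 : 0 <= \sum_(i in C) nu (lev T i) * `|x i| by rewrite sumr_ge0// => i _; rewrite mulr_ge0.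
by have := ler_wpM2r N0 rh; move: main => /=; lra.
Qed.

(** Each node of the class has w i of order 2^j h^(-j), and each of the first j
levels is an antichain. *)
Lemma class_early j (C : {set 'I_l}) : (0 < j)%N -> e <= h ^- j ->
  (forall i, i \in C -> 2 ^+ j.+1 * nu (lev T i) <= w i) ->
  (forall i, i \in C -> w i <= 2 ^+ j.+2 * nu (lev T i)) ->
  (forall i, i \in C -> (lev T i < j)%N) ->
  \sum_(i in C) w i * `|x i| <= j%:R * (8 * rho ^+ j) * M.
Proof.
move=> j0 eh Cw wC Cj; have hj : 0 < h ^+ j by rewrite exprn_gt0.
have wle i : i \in C -> w i <= 8 * rho ^+ j.
  move=> iC; apply: (le_trans (wC i iC)).
  apply: (@le_trans _ _ (2 ^+ j.+2 * (2 / h ^+ j))); last first.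
    by rewrite /rho expr_div_n !exprS le_eqVlt; apply/orP; left; apply/eqP; ring.
  rewrite ler_wpM2l ?exprn_ge0//; apply: le_trans (class_measure j0 eh Cw iC).
  rewrite (bigD1 (lv i))/=; first by rewrite lerDl sumr_ge0.
  by apply/existsP; exists i; rewrite iC !eqxx.
apply: (@le_trans _ _ (\sum_(i in C) 8 * rho ^+ j * `|x i|)).
  by apply: ler_sum => i iC; rewrite ler_wpM2r// wle.
have r0 : 0 <= 8 * rho ^+ j by rewrite mulr_ge0// exprn_ge0//; case/andP: rho01.
rewrite -mulr_sumr [leRHS]mulrAC [leRHS]mulrC ler_wpM2l//.
apply: (@le_trans _ _ (\sum_(m < j) \sum_(i < l | lev T i == m) `|x i|)); last first.
  apply: (@le_trans _ _ (\sum_(m < j) M)); first by apply: ler_sum => m _; exact: level_sum_le.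
  by rewrite sumr_const card_ord mulr_natl.
under [leRHS]eq_bigr do rewrite big_mkcond.
rewrite exchange_big/= big_mkcond/=; apply: ler_sum => i _; case: ifPn => [iC|_].
  by rewrite (bigD1 (Ordinal (Cj i iC)))//= eqxx lerDl sumr_ge0// => m _; case: ifP.
by apply: sumr_ge0 => m _; case: ifP.
Qed.

Lemma class_le j (C : {set 'I_l}) : (0 < j)%N -> e <= h ^- j ->
  (forall i, i \in C -> 2 ^+ j.+1 * nu (lev T i) <= w i <= 2 ^+ j.+2 * nu (lev T i)) ->
  \sum_(i in C) w i * `|x i| <= 32 * (j.+1%:R * rho ^+ j) * M.
Proof.
move=> j0 eh Cw; have hj : 0 < h ^+ j by rewrite exprn_gt0.
have M0 := bound_ge0; have r0 : 0 <= rho ^+ j by rewrite exprn_ge0//; case/andP: rho01.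
pose late := [set i in C | (j <= lev T i)%N]%SET.
pose early := [set i in C | (lev T i < j)%N]%SET.
have split_sum : \sum_(i in C) w i * `|x i| =
    \sum_(i in late) w i * `|x i| + \sum_(i in early) w i * `|x i|.
  rewrite (bigID (fun i : 'I_l => (j <= lev T i)%N))/=.
  by congr (_ + _); apply: eq_bigl => i; rewrite inE// -ltnNge.
have lateM : \sum_(i in late) w i * `|x i| <= 32 * rho ^+ j * M.
  apply: (@le_trans _ _ (2 ^+ j.+2 * \sum_(i in late) nu (lev T i) * `|x i|)).
    rewrite mulr_sumr; apply: ler_sum => i; rewrite inE => /andP[iC _].
    by rewrite mulrA ler_wpM2r//; case/andP: (Cw i iC).
  apply: (@le_trans _ _ (2 ^+ j.+2 * (8 / h ^+ j * M))).
    rewrite ler_wpM2l ?exprn_ge0//; apply: class_late => // i; rewrite inE => /andP[iC ji] //.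
    by case/andP: (Cw i iC).
  by rewrite /rho expr_div_n !exprS le_eqVlt; apply/orP; left; apply/eqP; ring.
have earlyM : \sum_(i in early) w i * `|x i| <= j%:R * (8 * rho ^+ j) * M.
  by apply: class_early => // i; rewrite inE => /andP[iC ij] //; case/andP: (Cw i iC).
rewrite split_sum; apply: le_trans (lerD lateM earlyM) _; rewrite -mulrDl ler_wpM2r//.
have := mulr_ge0 (ler0n R j) r0; rewrite -(natr1 j); lra.
Qed.

(** All nodes are distributed over the dyadic classes up to J.  The nodes beyond
are so light with respect to nu that together they make up at most a quarter of
S', which is absorbed on the left. *)
Lemma pairing_class_bound J : (l <= 2 ^ J)%N -> e <= h ^- J ->
  S' <= 2 * (4 + 32 * (1 - rho) ^- 2) * M.
Proof.
move=> lJ eJ; have M0 := bound_ge0; have /andP[r0 r1] := rho01.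
pose C j := [set i : 'I_l | 2 ^+ j.+1 * nu (lev T i) < w i <= 2 ^+ j.+2 * nu (lev T i)]%SET.
have low : \sum_(i < l) 4 * nu (lev T i) * `|x i| <= 4 * M.
  rewrite (eq_bigr (fun i : 'I_l => 4 * (nu (lev T i) * `|x i|))); last by move=> i _; rewrite mulrA.
  rewrite -mulr_sumr ler_wpM2l// (partition_big lv xpredT)//=.
  rewrite -[leRHS]mul1r -nu_sum1 mulr_suml; apply: ler_sum => m _.
  apply: le_trans (ler_wpM2l (nu0 m) (level_sum_le m)); rewrite mulr_sumr.
  rewrite le_eqVlt; apply/orP; left; apply/eqP; apply: eq_big => [i|i /eqP <-//].
  by rewrite -val_eqE.
have high (i : 'I_l) : 2 ^+ J.+2 * nu (lev T i) < w i -> w i * `|x i| <= S' / 2 ^+ J.+2.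
  move=> iJ; apply: (@le_trans _ _ (S' * nu (lev T i))).
    rewrite /nu [leRHS]mulrC divfK ?gt_eqF// /w -mulrA ler_wpM2l// /level_mass (bigD1 i)//=.
    by rewrite lerDl sumr_ge0// => k _; rewrite mulr_ge0.
  rewrite ler_wpM2l ?(ltW S'0)// -div1r ler_pdivlMr ?exprn_gt0// mulrC.
  apply: (le_trans (ltW iJ)); have := upper_dual_entry (lev T i) aD (bS i).
  by rewrite normrM (ger0_norm (a0 _)).
have pt (i : 'I_l) : w i * `|x i| <= 4 * nu (lev T i) * `|x i| +
    \sum_(j < J) (if i \in C j.+1 then w i * `|x i| else 0) + S' / 2 ^+ J.+2.
  have sum0 : 0 <= \sum_(j < J) (if i \in C j.+1 then w i * `|x i| else 0).
    by apply: sumr_ge0 => j _; case: ifP => // _; rewrite mulr_ge0.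
  have S20 : 0 <= S' / 2 ^+ J.+2 by rewrite divr_ge0 ?exprn_ge0// ltW.
  have low0 : 0 <= 4 * nu (lev T i) * `|x i| by rewrite mulr_ge0// mulr_ge0.
  have [iJ|iJ] := ltP (2 ^+ J.+2 * nu (lev T i)) (w i).
    by apply: (le_trans (high i iJ)); rewrite lerDr addr_ge0.
  (* The class of i is the least k for which its upper bound holds. *)
have ex : exists k, w i <= 2 ^+ k.+2 * nu (lev T i) by exists J.
  have [[|k] wk kmin] := ex_minnP ex.
    have wx : w i * `|x i| <= 4 * nu (lev T i) * `|x i|.
      by rewrite ler_wpM2r// (le_trans wk)// [4](_ : _ = 2 ^+ 2) -?natrX.
    by move: wx sum0 S20; lra.
  have kJ : (k < J)%N by apply: kmin.
  rewrite (bigD1 (Ordinal kJ))//= ifT; last first.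
    by rewrite inE wk andbT ltNge; apply/negP => /kmin; rewrite ltnn.
  set rest := \sum_(j < J | _) _.
  have rest0 : 0 <= rest by apply: sumr_ge0 => j _; case: ifP => // _; rewrite mulr_ge0.
  by move: S20 low0 rest0; lra.
have tot : S' <= \sum_(i < l) (4 * nu (lev T i) * `|x i| +
    \sum_(j < J) (if i \in C j.+1 then w i * `|x i| else 0) + S' / 2 ^+ J.+2).
  by rewrite {1}/S' pairing_levels; apply: ler_sum => i _; exact: pt.
rewrite !big_split/= in tot.
have mid : \sum_(i < l) \sum_(j < J) (if i \in C j.+1 then w i * `|x i| else 0) <=
    32 * (1 - rho) ^- 2 * M.
  rewrite exchange_big/=; apply: (@le_trans _ _ (\sum_(j < J) 32 * (j.+2%:R * rho ^+ j.+1) * M)).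
    apply: ler_sum => j _; rewrite -big_mkcond/=; apply: class_le => //.
      apply: (le_trans eJ); rewrite lef_pV2 ?posrE ?exprn_gt0// ler_weXn2l//.
      by rewrite ltW// (lt_trans _ h2)// ltr1n.
    by move=> i; rewrite inE => /andP[/ltW -> ->].
  rewrite -mulr_suml -mulr_sumr ler_wpM2r// ler_wpM2l//.
  apply: le_trans (sum_arith_geometric J.+1 rho01); rewrite big_ord_recl/= lerDr.
  by rewrite mulr_ge0.
have last4 : \sum_(i < l) S' / 2 ^+ J.+2 <= S' / 4.
  rewrite sumr_const card_ord -[leLHS]mulr_natl mulrCA ler_wpM2l ?(ltW S'0)//.
  rewrite ler_pdivrMr ?exprn_gt0// (_ : 4^-1 * 2 ^+ J.+2 = 2 ^+ J); last by rewrite !exprS; field.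
  by rewrite -natrX ler_nat.
have c0 : 0 <= (1 - rho) ^- 2 by rewrite invr_ge0 exprn_ge0// subr_ge0 ltW.
have cM := mulr_ge0 c0 M0.
by move: tot mid last4 low; lra.
Qed.

End NearMaximizer.
(** The supremum S need not be attained.  A gap of h^-(l+1) is small enough for the
classes up to l + 1; the nodes beyond are at most l in number, hence negligible. *)
Lemma pairing_bound a : upper_dual p SB a ->
  \sum_(i < l) `|a (lev T i) * b i (lev T i) * x i| <=
    4 * (4 + 32 * (1 - rho) ^- 2) * M.
Proof.
move=> aD; have M0 := bound_ge0; have /andP[r0 r1] := rho01.
pose V := [set v | exists2 a', upper_dual p SB a' /\ (forall m, 0 <= a' m) &
  v = \sum_(m < n) a' m * level_mass m].
have V1 : has_sup V.
  split; first by exists 0, (fun=> 0); [split=> //; exact: upper_dual0|rewrite big1// => m _; rewrite mul0r].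
  exists (\sum_(i < l) `|x i|) => _ [a' [a'D a'0] ->]; rewrite pairing_levels.
  apply: ler_sum => i _; rewrite ler_piMl//.
  by have := upper_dual_entry (lev T i) a'D (bS i); rewrite normrM (ger0_norm (a'0 _)).
pose S := sup V.
have SP a' : upper_dual p SB a' -> (forall m, 0 <= a' m) ->
    \sum_(m < n) a' m * level_mass m <= S.
  by move=> a'D a'0; apply: (sup_upper_bound V1); exists a'.
have aS : \sum_(i < l) `|a (lev T i) * b i (lev T i) * x i| <= S.
  apply: le_trans (SP _ (upper_dual_norm aD) (fun m => normr_ge0 _)).
  by rewrite (pairing_levels (fun m => `|a m|)); apply: ler_sum => i _; rewrite !normrM.
apply: (le_trans aS); have c0 : 0 <= (1 - rho) ^- 2 by rewrite invr_ge0 exprn_ge0// subr_ge0 ltW.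
have [S0|S0] := leP S 0; first by rewrite (le_trans S0)// !mulr_ge0// addr_ge0// mulr_ge0.
pose e := h ^- l.+1.
have e0 : 0 < e by rewrite invr_gt0 exprn_gt0.
have e2 : e <= 2^-1.
  rewrite lef_pV2 ?posrE ?exprn_gt0// (le_trans (ltW h2))// exprS ler_peMr// ?(ltW h0)//.
  by rewrite exprn_ege1// ltW// (lt_trans _ h2)// ltr1n.
have [_ [a' [a'D a'0] ->] near] : exists2 v, V v & (1 - e) * S < v.
  have [v Vv Sv] := sup_adherent (mulr_gt0 e0 S0) V1; exists v => //.
  by rewrite mulrBl mul1r.
have S'0 : 0 < \sum_(m < n) a' m * level_mass m.
  apply: lt_trans near; rewrite mulr_gt0//; lra.
have lJ : (l <= 2 ^ l.+1)%N by apply: (@leq_trans (2 ^ l)%N); rewrite ?leq_exp2l//; exact/ltnW/ltn_expl.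
have e01 : 0 <= e <= 1 by apply/andP; split; lra.
have := pairing_class_bound SP a'D a'0 S0 e01 (ltW near) S'0 lJ (lexx _).
set K := 4 + _; set S' := \sum_(m < n) _ in near *.
have : S / 2 <= (1 - e) * S by rewrite mulrC ler_wpM2r// ?(ltW S0)//; lra.
by lra.
Qed.

End FixedVector.
End TreeEstimate.

(** * Unconditional bases *)

(** If finite sums over far away sets stayed large, one could list each such set
contiguously; this gives a rearrangement whose partial sums are not Cauchy. *)
Lemma unconditional_small_sums (R : realType) (V : normedModType R) (u : nat -> V) :
  unconditionally_convergent u -> forall e : R, 0 < e ->
  exists N, forall s : seq nat, uniq s -> (forall i, i \in s -> (N <= i)%N) ->
    `|\sum_(i <- s) u i| <= e.
Proof.
move=> uu e e0; apply: contrapT => noN.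
have /choice[G GP] N : exists s : seq nat, [/\ uniq s, forall i, i \in s -> (N <= i)%N
    & e < `|\sum_(i <- s) u i|].
  apply: contrapT => noS; apply: noN; exists N => s us sN; rewrite leNgt.
  by apply/negP => es; apply: noS; exists s.
(* The k-th stretch [n k, n k.+1) contains the exceptional set G (n k); l k lists
   this set first and then the rest of the stretch. *)
pose nxt N := (maxn N (\max_(i <- G N) i)).+1.
pose n k := iter k nxt 0%N.
have nE k : n k.+1 = nxt (n k) by [].
pose l k := G (n k) ++ [seq i <- index_iota (n k) (n k.+1) | i \notin G (n k)].
pose P k := flatten [seq l j | j <- iota 0 k].
have PS k : P k.+1 = P k ++ l k.
  by rewrite /P -addn1 iotaD map_cat flatten_cat/= cats0.
have nS k : (n k < n k.+1)%N by rewrite nE ltnS leq_maxl.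
have lperm k : perm_eq (l k) (index_iota (n k) (n k.+1)).
  have [uG GN _] := GP (n k).
  rewrite /l; set I := index_iota _ _.
  have GI : perm_eq (G (n k)) [seq i <- I | i \in G (n k)].
    apply: uniq_perm => //; first by rewrite filter_uniq// iota_uniq.
    move=> i; rewrite mem_filter; case iG: (i \in G (n k)) => //=.
    rewrite mem_index_iota GN// andTb nE ltnS leq_max; apply/esym/orP; right.
    exact: leq_bigmax_seq.
  apply: (@perm_trans _ ([seq i <- I | i \in G (n k)] ++ [seq i <- I | i \notin G (n k)])).
    by rewrite perm_cat2r.
  have E := perm_filterC (fun i => i \in G (n k)) I I.
  by rewrite perm_refl in E.
have Pperm k : perm_eq (P k) (iota 0 (n k)).
  elim: k => // k IH; rewrite PS (perm_trans (perm_cat IH (lperm k)))//.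
  by rewrite /index_iota -{2}[n k]add0n -iotaD subnKC// ltnW.
have sizeP k : size (P k) = n k by rewrite (perm_size (Pperm k)) size_iota.
have uP k : uniq (P k) by rewrite (perm_uniq (Pperm k)) iota_uniq.
have memP k i : (i \in P k) = (i < n k)%N by rewrite (perm_mem (Pperm k)) mem_iota.
have kn k : (k <= n k)%N by elim: k => // k /leq_ltn_trans; apply.
have Ppre k k' : (k <= k')%N -> exists r, P k' = P k ++ r.
  move=> /subnKC <-; elim: (k' - k)%N => [|d [r IH]]; first by exists [::]; rewrite addn0 cats0.
  by exists (r ++ l (k + d)%N); rewrite addnS PS IH catA.
have nthP k k' i : (i < n k)%N -> (i < n k')%N -> nth 0%N (P k) i = nth 0%N (P k') i.
  wlog kk : k k' / (k <= k')%N => [hw ik ik'|ik _].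
    by have [/hw->//|/ltnW/hw->] := leqP k k'.
  by have [r ->] := Ppre _ _ kk; rewrite nth_cat sizeP ik.
pose s i := nth 0%N (P i.+1) i.
pose t m := index m (P m.+1).
have sE k i : (i < n k)%N -> s i = nth 0%N (P k) i.
  by move=> ik; apply: nthP => //; exact: kn.
have ts : cancel t s.
  move=> m; have mP : m \in P m.+1 by rewrite memP kn.
  by rewrite (sE m.+1) ?nth_index// -sizeP index_mem.
have st : cancel s t.
  move=> i; pose k := maxn i.+1 (s i).+1.
  have [r kE] := Ppre (s i).+1 k (leq_maxr _ _).
  have siP : s i \in P (s i).+1 by rewrite memP kn.
  have ik : (i < n k)%N by rewrite (leq_trans (leq_maxl i.+1 (s i).+1))// kn.
  have -> : t (s i) = index (s i) (P k) by rewrite kE index_cat siP.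
  by rewrite {1}(sE k)// index_uniq// sizeP.
have sb : bijective s by exists t.
have sumE k j : (j <= n k)%N -> series (u \o s) j = \sum_(i <- take j (P k)) u i.
  move=> jk; rewrite seriesEnat/= -(big_map s xpredT u); congr bigop.body.
  apply: (@eq_from_nth _ 0%N); first by rewrite size_map size_iota size_takel ?sizeP// subn0.
  move=> i; rewrite size_map size_iota subn0 => ij.
  rewrite (nth_map 0%N) ?size_iota ?subn0// nth_iota ?subn0// add0n nth_take//.
  by apply: sE; apply: leq_trans jk.
have /cvg_ex[v /cvgrPdist_lt/(_ _ (divr_gt0 e0 (ltr0n R 2)))[N _ NP]] := uu s sb.
have [uG GN GE] := GP (n N).
have sz : (n N + size (G (n N)) <= n N.+1)%N.
  by rewrite -(sizeP N.+1) PS size_cat sizeP leq_add2l size_cat leq_addr.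
have v1 : `|v - series (u \o s) (n N)| < e / 2 by apply: NP => /=.
have v2 : `|v - series (u \o s) (n N + size (G (n N)))%N| < e / 2.
  by apply: NP => /=; rewrite (leq_trans (kn N))// leq_addr.
move: GE; apply/negP; rewrite -leNgt ltW//.
have -> : \sum_(i <- G (n N)) u i = (v - series (u \o s) (n N)) -
    (v - series (u \o s) (n N + size (G (n N)))%N).
  have T1 : take (n N) (P N.+1) = P N by rewrite PS take_size_cat.
  have T2 : take (n N + size (G (n N))) (P N.+1) = P N ++ G (n N).
    by rewrite PS catA take_size_cat// size_cat sizeP.
  rewrite (sumE N.+1)//; last exact/ltnW/nS.
  rewrite (sumE N.+1)// T1 T2 big_cat/=.
  by rewrite opprB [RHS]addrC addrA subrK addrAC subrr add0r.
by rewrite [e]splitr (le_lt_trans (ler_normB _ _))// ltrD.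
Qed.

Lemma dualZ (R : realType) (V : normedModType R) (f : dual V) (a : R) v :
  f (a *: v) = a * f v.
Proof. by rewrite linearZ. Qed.

Lemma dual_norm_bound (R : realType) (V : normedModType R) (f : dual V) v :
  `|f v| <= `|f| * `|v|.
Proof.
have [->|v0] := eqVneq v 0; first by rewrite linear0 !normr0 mulr0.
have v0' : 0 < `|v| by rewrite normr_gt0.
have := @ler_dual_norm _ _ f (`|v|^-1 *: v).
rewrite normrZ normfV normr_id mulVf ?gt_eqF// => /(_ (lexx _)).
by rewrite dualZ normrM normfV normr_id mulrC ler_pdivrMr.
Qed.

(** Coefficients g_0, ..., g_(n-1) dominated by the norm, extending one vector at
a time: the finite-dimensional Hahn-Banach theorem. *)
Lemma hahn_banach_seq (R : realType) (V : normedModType R) (v : nat -> V) n :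
  exists g : nat -> R, g 0%N = `|v 0%N| /\
    forall c : nat -> R, `|\sum_(m < n.+1) c m * g m| <= `|\sum_(m < n.+1) c m *: v m|.
Proof.
elim: n => [|n [g [g0 gv]]].
  exists (fun=> `|v 0%N|); split=> // c.
  by rewrite !big_ord1 normrM normrZ normr_id.
pose G (c : nat -> R) := \sum_(m < n.+1) c m * g m.
pose W (c : nat -> R) := \sum_(m < n.+1) c m *: v m.
have gvW c : G c <= `|W c| by apply: le_trans (gv c); exact: ler_norm.
pose lo := [set G c - `|W c - v n.+1| | c in [set: nat -> R]].
have lohi c d : G c - `|W c - v n.+1| <= `|W d + v n.+1| - G d.
  rewrite lerBrDr addrAC lerBlDr.
  have -> : G c + G d = G (fun m => c m + d m).
    by rewrite /G -big_split; apply: eq_bigr => m _; rewrite mulrDl.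
  apply: le_trans (gvW _) _.
  have -> : W (fun m => c m + d m) = (W d + v n.+1) + (W c - v n.+1).
    rewrite addrACA subrr addr0 addrC /W -big_split.
    by apply: eq_bigr => m _; rewrite scalerDl.
  exact: ler_normD.
have lo_sup : has_sup lo.
  split; first by exists (G (fun=> 0) - `|W (fun=> 0) - v n.+1|), (fun=> 0).
  by exists (`|W (fun=> 0) + v n.+1| - G (fun=> 0)) => _ [c _ <-].
pose t := sup lo.
have tlo c : G c - `|W c - v n.+1| <= t by apply: sup_upper_bound => //; exists c.
have thi d : t <= `|W d + v n.+1| - G d.
  by apply: ge_sup; [exact: lo_sup.1|move=> _ [c _ <-]].
exists (fun m => if (m < n.+1)%N then g m else t); split=> // c.
rewrite big_ord_recr/= ltnn [in leRHS]big_ord_recr/=.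
rewrite (eq_bigr (fun m : 'I_n.+1 => c m * g m)) => [|m _]; last by rewrite ltn_ord.
rewrite -/(G c) -/(W c).
have GZ (a : R) d : G (fun m => a * d m) = a * G d.
  by rewrite /G mulr_sumr; apply: eq_bigr => m _; rewrite mulrA.
have WZ (a : R) d : W (fun m => a * d m) = a *: W d.
  by rewrite /W scaler_sumr; apply: eq_bigr => m _; rewrite scalerA.
have up d : G d + t <= `|W d + v n.+1|.
  by have := thi d; rewrite lerBrDr addrC.
have dn d : - (G d + t) <= `|W d + v n.+1|.
  have := tlo (fun m => -1 * d m); rewrite GZ WZ mulN1r scaleN1r -[- W d - _]opprD normrN.
  by rewrite lerBlDr -lerBlDl opprD.
have [->|s0] := eqVneq (c n.+1) 0; first by rewrite mul0r scale0r !addr0 gv.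
set s := c n.+1 in s0 *.
have -> : G c = s * G (fun m => s^-1 * c m) by rewrite GZ mulrA mulfV// mul1r.
have -> : W c = s *: W (fun m => s^-1 * c m) by rewrite WZ scalerA mulfV// scale1r.
rewrite -mulrDr -scalerDr normrM normrZ ler_wpM2l//.
by rewrite ler_norml up andbT lerNl dn.
Qed.

(** Multiplying by a ternary sequence changes signs and restricts the support. *)
Definition ternary (R : realType) (th : nat -> R) :=
  forall m, [|| th m == 0, th m == 1 | th m == -1].

Lemma ternary_bool (R : realType) (P : pred nat) : ternary (fun m => (P m)%:R : R).
Proof. by move=> m; case: (P m); rewrite /= ?mulr1n ?mulr0n eqxx ?orbT. Qed.

Section Basis.
Variables (R : realType) (Z : completeNormedModType R) (z : nat -> Z).
Variable f : nat -> dual Z.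
Hypothesis f_z : forall m n, f m (z n) = (m == n)%:R.
Hypothesis z_basis : unconditional_basis z.

Lemma coord_comb n (c : nat -> R) m : f m (\sum_(i < n) c i *: z i) =
  if (m < n)%N then c m else 0.
Proof.
rewrite linear_sum; case: ifPn => [mn|].
  rewrite (bigD1 (Ordinal mn))//= dualZ f_z eqxx mulr1 big1 ?addr0// => i im.
  rewrite dualZ f_z (_ : (m == i) = false) ?mulr0//.
  by apply: contra_neqF im => /eqP mi; apply/val_inj.
rewrite -leqNgt => nm; rewrite big1// => i _; rewrite [LHS]dualZ f_z.
by rewrite gtn_eqF ?mulr0// (leq_trans (ltn_ord i)).
Qed.

Lemma basis_expansion v : series (fun m => f m v *: z m) @ \oo --> v.
Proof.
have [a [av _]] := z_basis.1 v.
suff E m : f m v = a m.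
  by rewrite (_ : (fun m => _) = (fun m => a m *: z m))//; apply/funext => m; rewrite E.
apply/eqP; rewrite -subr_eq0 -normr_le0; apply/ler_addgt0Pl => e e0.
have F0 : 0 < `|f m| + 1 by rewrite ltr_pwDr.
have := av => /cvgrPdist_le/(_ _ (divr_gt0 e0 F0))[N _ /(_ (maxn N m.+1) (leq_maxl _ _))/=].
rewrite seriesEord/= => vN.
have -> : a m = f m (\sum_(i < maxn N m.+1) a i *: z i) by rewrite coord_comb leq_maxr.
rewrite -linearB addr0 (le_trans (dual_norm_bound _ _))//.
apply: (@le_trans _ _ ((`|f m| + 1) * (e / (`|f m| + 1)))).
  by rewrite ler_pM// lerDl.
by rewrite mulrC divfK ?gt_eqF.
Qed.

Lemma basis_neq0 m : z m != 0.
Proof.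
by apply: contra_eq_neq (f_z m m) => ->; rewrite linear0 eqxx eq_sym oner_eq0.
Qed.

Lemma bounded_partial_sums v : exists M, forall s : seq nat, uniq s ->
  `|\sum_(m <- s) f m v *: z m| <= M.
Proof.
have uu := z_basis.2 v (fun m => f m v) (@basis_expansion v).
have [N NP] := unconditional_small_sums uu ltr01.
exists (\sum_(m < N) `|f m v *: z m| + 1) => s us.
rewrite (bigID (fun m => (m < N)%N))/=.
apply: le_trans (ler_normD _ _) _; apply: lerD.
  apply: le_trans (ler_norm_sum _ _ _) _.
  rewrite -(big_mkord xpredT (fun m => `|f m v *: z m|)).
  by apply: ler_sum_subset => // m _ mN; rewrite mem_index_iota mN.
rewrite -big_filter; apply: NP; first exact: filter_uniq.
by move=> m; rewrite mem_filter -leqNgt => /andP[].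
Qed.

(** The uniform unconditionality constant, by the uniform boundedness principle. *)
Lemma unconditional_constant : exists2 K : R, 0 < K &
  forall v (th : nat -> R) n, ternary th ->
    `|\sum_(m < n) (th m * f m v) *: z m| <= K * `|v|.
Proof.
pose S (s : seq nat) v := \sum_(m <- s) f m v *: z m.
have Slin s : linear (S s).
  move=> a x y; rewrite /S scaler_sumr -big_split/=; apply: eq_bigr => m _.
  by rewrite linearP scalerDl scalerA.
pose Fam := [set S s | s in [set s | uniq s]].
have Fam_bdd g : Fam g -> bounded_fun_norm g /\ linear g.
  move=> [s us <-]; split=> // r.
  exists (\sum_(m <- s) `|f m| * r * `|z m|) => x xr.
  apply: le_trans (ler_norm_sum _ _ _) _; apply: ler_sum => m _.
  by rewrite normrZ ler_wpM2r// (le_trans (dual_norm_bound _ _))// ler_wpM2l.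
have Fam_pt : pointwise_bounded Fam.
  move=> v; have [M MP] := bounded_partial_sums v; exists M => _ [s us <-].
  exact: MP.
have [M MP] := Banach_Steinhauss Fam_bdd Fam_pt 1.
have SM s v : uniq s -> `|S s v| <= `|M| * `|v|.
  move=> us; have [->|v0] := eqVneq v 0.
    by rewrite /S big1 ?normr0 ?mulr0// => m _; rewrite linear0 scale0r.
  have v0' : 0 < `|v| by rewrite normr_gt0.
  have -> : v = `|v| *: (`|v|^-1 *: v) by rewrite scalerA mulfV ?scale1r ?gt_eqF.
  have := Slin s `|v| (`|v|^-1 *: v) 0.
  have -> : S s 0 = 0 by rewrite /S big1// => m _; rewrite linear0 scale0r.
  rewrite !addr0 => ->; rewrite !normrZ normfV !normr_id mulVf ?gt_eqF// mulr1 mulrC.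
  rewrite ler_wpM2r//; apply: (@le_trans _ _ M); last exact: ler_norm.
  by apply: MP; [exists s|rewrite normrZ normfV normr_id mulVf ?gt_eqF].
exists (2 * `|M| + 1); first by rewrite ltr_wpDl// mulr_ge0.
move=> v th n tth.
have uI (P : pred nat) : uniq [seq m <- index_iota 0 n | P m] by rewrite filter_uniq// iota_uniq.
have -> : \sum_(m < n) (th m * f m v) *: z m =
    S [seq m <- index_iota 0 n | th m == 1] v - S [seq m <- index_iota 0 n | th m == -1] v.
  rewrite /S !big_filter !big_mkord [X in _ = X - _]big_mkcond [X in _ = _ - X]big_mkcond.
  rewrite -sumrB; apply: eq_bigr => m _; have m1 : (-1 == 1 :> R) = false.
    by apply/negbTE; rewrite lt_eqF// (lt_trans (ltrN10 _)).
  have /or3P[/eqP ->|/eqP ->|/eqP ->] := tth m.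
  - by rewrite eq_sym oner_eq0 eq_sym oppr_eq0 oner_eq0 subrr mul0r scale0r.
  - by rewrite eqxx eq_sym m1 subr0 mul1r.
  - by rewrite m1 eqxx sub0r mulN1r scaleNr.
apply: le_trans (ler_normB _ _) _; apply: le_trans (lerD (SM _ _ (uI _)) (SM _ _ (uI _))) _.
by rewrite -mulrDl ler_wpM2r// -mulr2n -[leLHS]mulr_natl lerDl.
Qed.

(** The unit ball of an equivalent lattice norm, described without forming a
supremum over the ternary multipliers. *)
Definition solid_ball (c : nat -> R) :=
  forall n th, ternary th -> `|\sum_(m < n) (th m * c m) *: z m| <= 1.

Lemma ternary_mul (t1 t2 : nat -> R) : ternary t1 -> ternary t2 -> ternary (fun m => t1 m * t2 m).
Proof.
move=> h1 h2 m; have /or3P[/eqP ->|/eqP ->|/eqP ->] := h1 m; rewrite ?mul0r ?eqxx//.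
  by rewrite mul1r.
have /or3P[/eqP ->|/eqP ->|/eqP ->] := h2 m; rewrite ?mulr0 ?mulr1 ?mulrNN ?mulr1 ?eqxx ?orbT//.
Qed.

Lemma solid_ball_ternary c th : solid_ball c -> ternary th -> solid_ball (fun m => th m * c m).
Proof.
move=> cS tth n t2 tt2; have := cS n _ (ternary_mul tt2 tth).
by rewrite (eq_bigr (fun m : 'I_n => (t2 m * (th m * c m)) *: z m)) => // m _; rewrite mulrA.
Qed.

Lemma solid_ball_entry c m : solid_ball c -> `|c m| * `|z m| <= 1.
Proof.
move=> /(_ m.+1 (fun i => (i == m)%:R)); rewrite big_ord_recr/= eqxx mul1r big1 => [|i _].
  by rewrite add0r normrZ; apply; exact: ternary_bool.
by rewrite ltn_eqF// mul0r scale0r.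
Qed.

(** The form of the upper p-estimate in which blocks may vanish: blocks are nonzero
by definition, so the colours with zero sum have to be left out. *)
Lemma upper_estimate_colour (p C : R) : 0 < p -> 0 < C ->
  (forall (n : nat) (u : 'I_n -> Z) (F : 'I_n -> {fset nat}),
      (forall i, block z (F i) (u i)) ->
      (forall i j, i != j -> [disjoint F i & F j]%fset) ->
      `|\sum_(i < n) u i| <= C * (\sum_(i < n) `|u i| `^ p) `^ p^-1) ->
  forall (c : nat -> R) n k (chi : nat -> 'I_k),
    `|\sum_(m < n) c m *: z m| <=
    C * (\sum_j `|\sum_(m < n | chi m == j) c m *: z m| `^ p) `^ p^-1.
Proof.
move=> p0 C0 Cup c n k chi.
pose F j : {fset nat} := fset_of_ords [set m : 'I_n | (chi m == j) && (c m != 0)]%SET.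
pose u j := \sum_(m < n | chi m == j) c m *: z m.
have uF j : u j = \sum_(m <- F j) c m *: z m.
  rewrite sum_fset_of_ords /u (bigID (fun m : 'I_n => c m == 0))/= big1 ?add0r => [|m /andP[_ /eqP ->]].
    by apply: eq_bigl => m; rewrite inE.
  by rewrite scale0r.
have u0 j : u j = 0 -> F j = fset0.
  move=> uj0; apply/fsetP => m; rewrite inE; apply/negP => /fset_of_ordsP[i].
  rewrite inE => /andP[ij ci] _; move: ci; apply/negP; rewrite negbK.
  have E : \sum_(m < n) (if chi m == j then c m else 0) *: z m = u j.
    by rewrite /u [RHS]big_mkcond; apply: eq_bigr => l _; case: ifP; rewrite ?scale0r.
  have := coord_comb n (fun m => if chi m == j then c m else 0) i.
  by rewrite ltn_ord ij E uj0 linear0 => <-.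
pose s := [seq j <- enum 'I_k | u j != 0].
have us : uniq s by rewrite filter_uniq// enum_uniq.
have sumS (V : nmodType) (h : 'I_k -> V) : (forall j, u j = 0 -> h j = 0) ->
    \sum_j h j = \sum_(i < size s) h (tnth (in_tuple s) i).
  move=> hu; rewrite -(big_tnth _ _ s xpredT h) big_filter big_enum_cond/=.
  rewrite (bigID (fun j => u j == 0))/= big1 ?add0r// => j /eqP; exact: hu.
have -> : \sum_(m < n) c m *: z m = \sum_j u j.
  by rewrite (partition_big (fun m : 'I_n => chi m) xpredT).
rewrite (sumS _ u)// (sumS _ (fun j => `|u j| `^ p)) => [|j ->]; last first.
  by rewrite normr0 powR0// gt_eqF.
apply: (Cup _ _ (fun i => F (tnth (in_tuple s) i))) => [i|i i' ii'].
  have : tnth (in_tuple s) i \in s by exact: mem_tnth.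
  rewrite mem_filter => /andP[ui _]; split=> //.
  exists c; split; last exact: uF.
  by move=> m /fset_of_ordsP[l + ->]; rewrite inE => /andP[].
apply/fdisjointP => m /fset_of_ordsP[l + ->]; rewrite inE => /andP[/eqP li _].
apply/negP => /fset_of_ordsP[l' + /val_inj ll]; rewrite -ll inE li => /andP[/eqP tt _].
by move: ii'; rewrite -(inj_eq (tuple_uniqP (in_tuple s) us)) tt eqxx.
Qed.

(** A norming functional for a finite combination of the basis, rescaled by the
constant of the upper estimate, lies in the p-dual of the solid ball. *)
Lemma norming_upper_dual (p : R) : 1 < p -> upper_estimate p z ->
  exists2 C : R, 0 < C & forall (c : nat -> R) n, exists2 a : nat -> R,
    upper_dual p solid_ball a & `|\sum_(m < n) c m *: z m| <= C * \sum_(m < n) a m * c m.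
Proof.
move=> p1 [C [C0 Cup]]; exists C => // c n.
have p0 : 0 < p by rewrite (lt_trans ltr01).
pose v i := if i is m.+1 then z m else \sum_(m < n) c m *: z m.
have [g [g0 gv]] := hahn_banach_seq v n.
pose a m := if (m < n)%N then g m.+1 / C else 0.
have gz (d : nat -> R) : \sum_(m < n) d m * g m.+1 <= `|\sum_(m < n) d m *: z m|.
  have := gv (fun i => if i is m.+1 then d m else 0).
  rewrite !big_ord_recl/= mul0r scale0r !add0r; apply: le_trans; exact: ler_norm.
exists a; last first.
  rewrite mulr_sumr (eq_bigr (fun m : 'I_n => c m * g m.+1)) => [|m _]; last first.
    by rewrite /a ltn_ord; field; rewrite gt_eqF.
  have := gv (fun i => if i is m.+1 then c m else -1).
  rewrite !big_ord_recl/= scaleN1r addNr normr0 normr_le0 mulN1r g0 addrC subr_eq0.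
  by move=> /eqP ->.
move=> N k chi u la uS la0 la1.
pose th m := Num.sg (g m.+1 * u (chi m) m).
have tth : ternary th by move=> m; rewrite /th; case: sgrP; rewrite eqxx ?orbT.
pose d m := la (chi m) * (th m * u (chi m) m).
apply: (@le_trans _ _ (\sum_(m < n) la (chi m) * `|a m * u (chi m) m|)).
  rewrite -(big_mkord xpredT (fun m => la (chi m) * `|a m * u (chi m) m|)).
  rewrite -[leRHS](big_mkord xpredT (fun m => la (chi m) * `|a m * u (chi m) m|)).
  rewrite (bigID (fun m => (m < n)%N))/= [X in _ + X]big1 ?addr0; last first.
    by move=> m /negbTE mn; rewrite /a mn mul0r normr0 mulr0.
  apply: ler_sum_subset => [m||m _ mn]; rewrite ?iota_uniq ?mulr_ge0//.
  by rewrite mem_index_iota mn.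
rewrite (eq_bigr (fun m : 'I_n => d m * g m.+1 / C)) => [|m _]; last first.
  have Ci : 0 < C^-1 by rewrite invr_gt0.
  rewrite /a ltn_ord /d /th (_ : g m.+1 / C * _ = (g m.+1 * u (chi m) m) / C); last by ring.
  by rewrite normrM (gtr0_norm Ci) normrEsg; ring.
rewrite -mulr_suml ler_pdivrMr// mul1r; apply: (le_trans (gz d)).
apply: (le_trans (upper_estimate_colour p0 C0 Cup d n chi)).
rewrite ler_piMr ?(ltW C0)//.
have S0 : 0 <= \sum_j la j `^ p by apply: sumr_ge0 => j _; exact: powR_ge0.
apply: (@le_trans _ _ (1 `^ p^-1)); last by rewrite powR1.
apply: ge0_ler_powR; rewrite ?nnegrE ?invr_ge0 ?(ltW p0)//.
  by apply: sumr_ge0 => j _; exact: powR_ge0.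
apply: le_trans la1; apply: ler_sum => j _.
apply: ge0_ler_powR; rewrite ?nnegrE ?(ltW p0)//.
pose tj m : R := th m * (chi m == j)%:R.
have ttj : ternary tj.
  by apply: ternary_mul => //; exact: ternary_bool.
have := uS j n tj ttj.
have -> : \sum_(m < n | chi m == j) d m *: z m =
    la j *: \sum_(m < n) (tj m * u j m) *: z m.
  rewrite scaler_sumr big_mkcond; apply: eq_bigr => m _; rewrite scalerA /tj /d.
  by case: eqP => [->|_]; rewrite ?mulr1// mulr0 mul0r mulr0 scale0r.
by rewrite normrZ (ger0_norm (la0 j)) => uj; rewrite ler_piMr.
Qed.

End Basis.

(** * The tree of grid sequences *)

Lemma bounded_seqs D m : exists l : seq (seq int), forall s : seq int,
  (size s <= m)%N -> (forall x, x \in s -> (absz x <= D)%N) -> s \in l.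
Proof.
pose I : seq int := [seq Posz n | n <- iota 0 D.+1] ++ [seq - Posz n | n <- iota 0 D.+1].
have IP x : (absz x <= D)%N -> x \in I.
  case: x => n /= nD; rewrite mem_cat; apply/orP; [left|right].
    by apply: map_f; rewrite mem_iota.
  by rewrite NegzE; apply: (map_f (fun k => - Posz k)); rewrite mem_iota.
elim: m => [|m [l IH]].
  by exists [:: [::]] => s; rewrite leqn0 => /nilP ->; rewrite inE.
exists ([::] :: [seq x :: s | x <- I, s <- l]) => -[|x s] sm sD; first by rewrite inE.
rewrite in_cons; apply/orP; right. apply/flatten_mapP; exists x.
  by apply: IP; apply: sD; rewrite mem_head.
by apply: map_f; apply: IH => // y ys; apply: sD; rewrite inE ys orbT.
Qed.

Section GridTree.
Variables (R : realType) (Z : completeNormedModType R) (z : nat -> Z).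
Variables (ka h : R).
Hypotheses (z0 : forall m, z m != 0) (ka0 : 0 < ka) (h1 : 1 <= h).

(** Rounding to multiples of mesh m in every coordinate m changes a vector by at
most ka in norm, and by no more after any sign changes. *)
Definition mesh m : R := ka * 2^-1 ^+ m.+1 / `|z m|.

Definition grid (s : seq int) m : R := (nth 0 s m)%:~R * mesh m.

Definition code (s : seq int) : nat := choice.pickle s.

Definition valid (s : seq int) : Prop := s != [::] /\ solid_ball z (grid s).

(** A number that encodes no node stands for the empty sequence.  It gets itself as
level and is comparable to nothing, and its unit vector will be sent to 0. *)
Definition node (i : nat) : seq int :=
  if (pickle_inv i : option (seq int)) is Some s then if `[< valid s >] then s else [::] else [::].

Definition node_lev i := if node i == [::] then i else (size (node i)).-1.

Definition node_anc : rel nat := fun i j =>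
  [&& node i != [::], (size (node i) < size (node j))%N
    & take (size (node i)) (node j) == node i].

(** The number of draws needed for the m-th dyadic class when h = 2^p. *)
Definition node_width m := (Num.truncn (h ^+ m / 4)).+1.

Lemma z_gt0 m : 0 < `|z m|. Proof. by rewrite normr_gt0. Qed.

Lemma mesh_gt0 m : 0 < mesh m.
Proof. by rewrite divr_gt0 ?z_gt0// mulr_gt0// exprn_gt0// invr_gt0. Qed.

Lemma mesh_norm m : mesh m * `|z m| = ka * 2^-1 ^+ m.+1.
Proof. by rewrite divfK// gt_eqF// z_gt0. Qed.

Lemma solid_ball0 : solid_ball z (fun=> 0).
Proof. by move=> n th _; rewrite big1 ?normr0// => m _; rewrite mulr0 scale0r. Qed.

Lemma node_valid i : node i != [::] -> valid (node i) /\ i = code (node i).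
Proof.
rewrite /node; case E: pickle_inv => [s|//]; case: asboolP => // sv _; split=> //.
by have := @pickle_invK (seq int) i; rewrite E.
Qed.

Lemma node_pickle s : valid s -> node (code s) = s.
Proof. by move=> sv; rewrite /node /code pickleK_inv; case: asboolP. Qed.

Lemma grid_solid i : solid_ball z (grid (node i)).
Proof.
have [E|/node_valid[[]]//] := eqVneq (node i) [::].
rewrite E (_ : grid [::] = (fun=> 0)); first exact: solid_ball0.
by apply/funext => m; rewrite /grid nth_nil mul0r.
Qed.

Lemma node_lev_finite m : exists B, forall i, (node_lev i < m)%N -> (i < B)%N.
Proof.
pose D := Num.truncn (2 ^+ m / ka).
have [l lP] := bounded_seqs D m.
exists (maxn m (\max_(s <- l) code s).+1) => i; rewrite /node_lev leq_max.
have [E ->//|ne] := eqVneq (node i) [::].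
have [[_ sv] ->] := node_valid ne; rewrite (node_pickle (node_valid ne).1) => im.
have im' : (size (node i) <= m)%N by move: im; case: (node i) ne.
apply/orP; right; rewrite ltnS; apply: leq_bigmax_seq => //; apply: lP => // x xs.
rewrite -(nth_index 0 xs); set k := index x _.
have km : (k < m)%N by apply: leq_trans im'; rewrite index_mem.
rewrite truncn_ge_nat ?divr_ge0 ?exprn_ge0 ?(ltW ka0)// ler_pdivlMr//.
have := solid_ball_entry k sv; rewrite /grid normrM -mulrA (gtr0_norm (mesh_gt0 k)) mesh_norm.
rewrite natr_absz mulrA exprVn ler_pdivrMr ?exprn_gt0// mul1r intr_norm => /le_trans; apply.
by rewrite ler_weXn2l// ler1n.
Qed.

Lemma node_anc_lev i j : node_anc i j -> (node_lev i < node_lev j)%N.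
Proof.
move=> /and3P[ni ij _]; rewrite /node_lev (negPf ni).
have nj : node j != [::] by apply: contraTneq ij => ->; rewrite ltn0.
rewrite (negPf nj); move: ni nj ij.
by case: (node i) => // x s _; case: (node j).
Qed.

Lemma node_anc_grid i j : node_anc i j ->
  grid (node i) (node_lev i) = grid (node j) (node_lev i).
Proof.
move=> /and3P[ni ij /eqP ijE]; rewrite /node_lev (negPf ni) /grid; congr (_%:~R * _).
rewrite -{1}ijE nth_take//; by case: (node i) ni.
Qed.

Lemma node_width_homo : {homo node_width : m n / (m <= n)%N}.
Proof.
move=> m n mn; rewrite ltnS le_truncn// ler_wpM2r// ?invr_ge0//.
by rewrite ler_weXn2l.
Qed.

Definition grid_tree : leveled_order :=
  LeveledOrder node_lev_finite node_anc_lev (fun m => ltn0Sn _) node_width_homo.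

Lemma grid_tree_width j m : (j <= m)%N ->
  (Num.truncn (h ^+ j / 4) < width grid_tree m)%N.
Proof. exact: node_width_homo. Qed.

Definition branch (s : seq int) : seq nat :=
  [seq code (take k.+1 s) | k <- iota 0 (size s)].

Lemma grid_take s k m : grid (take k s) m = (m < k)%:R * grid s m.
Proof.
rewrite /grid; case: ltnP => [mk|km]; first by rewrite nth_take// mul1r.
by rewrite mul0r nth_default ?mul0r// size_take_min geq_min km.
Qed.

Lemma valid_take s k : (k < size s)%N -> solid_ball z (grid s) -> valid (take k.+1 s).
Proof.
move=> ks sS; split; first by case: s ks sS.
rewrite (_ : grid _ = (fun m => (m < k.+1)%:R * grid s m)).
  by apply: solid_ball_ternary => //; exact: ternary_bool.
by apply/funext => m; rewrite grid_take.
Qed.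

Section Branch.
Variable s : seq int.
Hypothesis sS : solid_ball z (grid s).

Lemma node_branch k : (k < size s)%N -> node (code (take k.+1 s)) = take k.+1 s.
Proof. by move=> ks; rewrite node_pickle//; exact: valid_take. Qed.

Lemma size_take_branch k : (k < size s)%N -> size (take k.+1 s) = k.+1.
Proof. by move=> ks; rewrite size_takel. Qed.

Lemma lev_branch k : (k < size s)%N -> node_lev (code (take k.+1 s)) = k.
Proof.
move=> ks; rewrite /node_lev node_branch// -size_eq0 size_take_branch//.
Qed.

Lemma branch_comparable i j : i \in branch s -> j \in branch s -> i != j ->
  node_anc i j || node_anc j i.
Proof.
have anc k l : (k < l)%N -> (l < size s)%N ->
    node_anc (code (take k.+1 s)) (code (take l.+1 s)).
  move=> kl ls; have ks := ltn_trans kl ls; rewrite /node_anc !node_branch//.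
  rewrite !size_take_branch// ltnS kl -size_eq0 size_take_branch//=.
  by rewrite take_takel// ltnS ltnW.
move=> /mapP[k]; rewrite mem_iota => /= ks -> /mapP[l]; rewrite mem_iota => /= ls -> kl.
have [lt|lt|E] := ltngtP k l; [by rewrite anc|by rewrite [X in _ || X]anc ?orbT|].
by rewrite E eqxx in kl.
Qed.

Lemma branch_uniq : uniq (branch s).
Proof.
rewrite map_inj_in_uniq ?iota_uniq// => k l; rewrite !mem_iota => /= ks ls.
move=> /(pcan_inj choice.pickleK)/(congr1 size); rewrite !size_take_branch//.
by case.
Qed.

(** An antichain meets a branch at most once; the factor 2 is due to the weights. *)
Lemma branch_norm :
  `|\sum_(j <- branch s) unit_vec (level_family R grid_tree) j| <= 2.
Proof.
set xi := \sum_(j <- _) _.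
have xiE i : coef xi i = (i \in branch s)%:R.
  have := coef_comb (level_family R grid_tree) (fun=> 1) i branch_uniq.
  rewrite (eq_bigr (unit_vec (level_family R grid_tree))) => [|j _]; last by rewrite scale1r.
  by move=> ->; case: ifP.
apply: family_norm_le => A [Aanc _]; apply: le_trans (wsum_le_sum _ _ _) _.
rewrite -[leRHS]mulr1 ler_pM2l//.
rewrite (eq_bigr (fun i => (i \in branch s)%:R)) => [|i _]; last first.
  by rewrite xiE ger0_norm ?ler0n.
have [[i iA ib]|none] := pselect (exists2 i, i \in A & i \in branch s); last first.
  rewrite big_seq big1// => i iA; case ib: (i \in branch s) => //.
  by exfalso; apply: none; exists i.
rewrite (big_rem i)//= ib big_seq big1 ?addr0// => j.
rewrite mem_rem_uniq ?fset_uniq// !inE => /andP[ji jA].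
case jb: (j \in branch s) => //.
by case/orP: (branch_comparable jb ib ji) => [/(negP (Aanc _ _ jA iA))|/(negP (Aanc _ _ iA jA))].
Qed.

Lemma sum_branch (V : nmodType) (g : nat -> V) :
  \sum_(j <- branch s) g j = \sum_(k < size s) g (code (take k.+1 s)).
Proof. by rewrite big_map -{1}[size s]subn0 big_mkord. Qed.

End Branch.

End GridTree.

(** * Maps onto Z and quotients *)

Section Synthesis.
Variables (R : realType) (F : weighted_family R) (Z : completeNormedModType R).
Variables (q : nat -> Z) (C : R).
Local Notation X := (family_space F).
Hypothesis C0 : 0 < C.
Hypothesis qC : forall (x : nat -> R) l M,
  (forall A, fam F A -> (forall i, i \in A -> (i < l)%N) -> \sum_(i <- A) `|x i| <= M) ->
  `|\sum_(i < l) x i *: q i| <= C * M.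

Definition synthesis (u : X) : Z := limn (series (fun i => u i *: q i)).

Lemma synthesis_cvg (u : X) : series (fun i => u i *: q i) @ \oo --> synthesis u.
Proof.
suff : cvgn (series (fun i => u i *: q i)) by [].
apply/cauchy_cvgP/cauchy_exP => e e0.
have [k uk] := tail_small u (divr_gt0 (divr_gt0 e0 C0) (ltr0n R 2)).
exists (series (fun i => u i *: q i) k); exists k => // l /= kl.
rewrite -ball_normE/= distrC sub_series_geq//.
have -> : \sum_(k <= i < l) u i *: q i =
    \sum_(i < l) (if (k <= i)%N then u i else 0) *: q i.
  rewrite big_geq_mkord big_mkcond; apply: eq_bigr => i _ /=.
  by case: ifP => //; rewrite scale0r.
apply: (@le_lt_trans _ _ (C * (e / C / 2))); last first.
  rewrite mulrA mulrCA mulfV ?gt_eqF// mulr1 ltr_pdivrMr// ltr_pMr// ltr1n//.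
apply: (qC (x := fun i => if (k <= i)%N then u i else 0)) => A FA _.
apply: le_trans (uk A FA); rewrite [leRHS]big_mkcond.
by apply: ler_sum => i _; case: ifP; rewrite ?normr0.
Qed.

Lemma synthesis_bound (u : X) : `|synthesis u| <= C * `|u|.
Proof.
apply/ler_addgt0Pr => e e0.
move/cvgrPdist_le/(_ e e0) : (@synthesis_cvg u) => [N _ /(_ N (leqnn _))/= uN].
rewrite -[synthesis u](subrK (series (fun i => u i *: q i) N)) addrC.
apply: le_trans (ler_normD _ _) _; apply: lerD => //.
rewrite seriesEord/=; apply: (qC (x := coef u)) => A FA _.
by apply: le_trans (wsum_le u FA); exact: sum_le_wsum.
Qed.

Lemma synthesis_linear : linear synthesis.
Proof.
move=> a u v; apply/eqP; rewrite -subr_eq0 -normr_le0; apply/ler_addgt0Pl => e e0.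
rewrite addr0; have e3 : 0 < e / 3 by rewrite divr_gt0.
have a1 : 0 < `|a| + 1 by rewrite ltr_pwDr.
move/cvgrPdist_le/(_ _ (divr_gt0 e3 a1)) : (@synthesis_cvg u) => [N1 _ uP].
move/cvgrPdist_le/(_ _ e3) : (@synthesis_cvg v) => [N2 _ vP].
move/cvgrPdist_le/(_ _ e3) : (@synthesis_cvg (a *: u + v)) => [N3 _ wP].
pose N := maxn N1 (maxn N2 N3).
have {uP} := uP N (leq_maxl _ _); have {vP} := vP N; have {wP} := wP N.
rewrite /= !leq_max !leqnn !orbT => /(_ isT) wP /(_ isT) vP uP.
pose sU (x : X) : Z := series (fun i => coef x i *: q i) N.
have sE : sU (a *: u + v) = a *: sU u + sU v.
  rewrite /sU !seriesEnat/= scaler_sumr -big_split/=; apply: eq_bigr => i _.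
  by rewrite coefD coefZ scalerDl scalerA.
have -> : synthesis (a *: u + v) - (a *: synthesis u + synthesis v) =
    (synthesis (a *: u + v) - sU (a *: u + v)) - (a *: (synthesis u - sU u) +
     (synthesis v - sU v)).
  rewrite sE scalerBr [in RHS]addrACA -[in RHS]opprD [in RHS]opprB addrA subrK.
  by rewrite opprD.
have -> : e = e / 3 + (e / 3 + e / 3) by field.
apply: le_trans (ler_normB _ _) _; apply: lerD => //.
apply: le_trans (ler_normD _ _) _; apply: lerD => //.
rewrite normrZ; apply: (@le_trans _ _ ((`|a| + 1) * (e / 3 / (`|a| + 1)))).
  by apply: ler_pM => //; rewrite lerDl.
by rewrite mulrC divfK ?gt_eqF.
Qed.

Lemma synthesis_unit j : synthesis (unit_vec F j) = q j.
Proof.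
apply/eqP; rewrite -subr_eq0 -normr_le0; apply/ler_addgt0Pl => e e0; rewrite addr0.
move/cvgrPdist_le/(_ e e0) : (@synthesis_cvg (unit_vec F j)).
move=> [N _ /(_ (maxn N j.+1) (leq_maxl _ _))/=]; rewrite seriesEord/=.
have jN : (j < maxn N j.+1)%N by rewrite leq_maxr.
rewrite (bigD1 (Ordinal jN))//= coef_unit eqxx scale1r big1 ?addr0// => i ij.
by rewrite coef_unit (_ : (i == j :> nat) = false) ?scale0r//; exact: negbTE.
Qed.

End Synthesis.

(** If every vector is within half its norm of the image of a vector of
comparable norm, then iterating on the remainders gives exact preimages. *)
Lemma approx_lift (R : realType) (X Z : completeNormedModType R) (Q : X -> Z)
    (C1 C : R) :
  linear Q -> 0 < C -> (forall x, `|Q x| <= C1 * `|x|) ->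
  (forall v, exists2 xi, `|xi| <= C * `|v| & `|v - Q xi| <= 2^-1 * `|v|) ->
  forall v, exists2 xi, Q xi = v & `|xi| <= 2 * C * `|v|.
Proof.
move=> Ql C0 QC app v.
have Q0 : Q 0 = 0 by apply/normr0_eq0/le_anti; rewrite normr_ge0 andbT (le_trans (QC _))// normr0 mulr0.
have QD x y : Q (x + y) = Q x + Q y by rewrite -[x]scale1r Ql !scale1r.
have QB x y : Q (x - y) = Q x - Q y by rewrite addrC -scaleN1r Ql scaleN1r addrC.
have /choice[g gP] w : exists xi, `|xi| <= C * `|w| /\ `|w - Q xi| <= 2^-1 * `|w|.
  by have [xi ? ?] := app w; exists xi.
pose r n := iter n (fun w => w - Q (g w)) v.
have rS n : r n.+1 = r n - Q (g (r n)) by [].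
have rle n : `|r n| <= `|v| * 2^-1 ^+ n.
  elim: n => [|n IH]; first by rewrite expr0 mulr1.
  rewrite rS (le_trans (gP _).2)// exprS mulrCA ler_wpM2l// invr_ge0//.
pose u n := g (r n).
have ule n : `|u n| <= geometric (C * `|v|) 2^-1 n.
  by rewrite (le_trans (gP _).1)//= -mulrA ler_wpM2l ?(ltW C0).
have half1 : `|2^-1 : R| < 1 by rewrite gtr0_norm ?invr_gt0// invf_lt1// ltr1n.
have cu : cvgn (series u).
  apply: normed_cvg; apply: (@series_le_cvg _ _ (geometric (C * `|v|) 2^-1)) => [n|n|n|].
  - exact: normr_ge0.
  - exact: le_trans (normr_ge0 _) (ule n).
  - exact: ule.
  - exact: is_cvg_geometric_series.
have Qs n : Q (series u n) = v - r n.
  elim: n => [|n IH]; first by rewrite seriesEnat/= big_geq// Q0 subrr.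
  have -> : series u n.+1 = series u n + u n by rewrite -(seriesSB u n) addrC subrK.
  by rewrite QD IH rS opprB addrA addrAC.
have sle n : `|series u n| <= 2 * C * `|v|.
  rewrite seriesEnat/= (le_trans (ler_norm_sum _ _ _))//.
  apply: (@le_trans _ _ (series (geometric (C * `|v|) 2^-1) n)).
    by rewrite seriesEnat/=; apply: ler_sum => i _; exact: ule.
  apply: le_trans (geometric_le_lim n _ _ half1) _; rewrite ?invr_gt0//.
    by rewrite mulr_ge0// ltW.
  by rewrite le_eqVlt; apply/orP; left; apply/eqP; field.
have /cvg_ex[xi sxi] := cu; exists xi.
  apply/eqP; rewrite -subr_eq0 -normr_le0; apply/ler_addgt0Pl => e e0; rewrite addr0.
  have e2 : 0 < e / 2 by rewrite divr_gt0.
  have D0 : 0 < `|C1| + 1 by rewrite ltr_pwDr.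
  have rcvg : (fun n => `|v| * 2^-1 ^+ n) @ \oo --> (0 : R).
    rewrite -[X in _ --> X](mulr0 `|v|); apply: cvgMr; exact: cvg_expr.
  move/cvgrPdist_le/(_ _ (divr_gt0 e2 D0)) : (sxi) => [N1 _ /(_ _ (leq_maxl N1 _)) sP].
  move/cvgrPdist_le/(_ _ e2) : rcvg => [N2 _ /(_ _ (leq_maxr N1 N2)) rP].
  move: sP => /(_ N2); set n := maxn N1 N2 in rP * => /= sP.
  have -> : Q xi - v = Q (xi - series u n) - r n by rewrite QB Qs opprB addrA addrAC addrK.
  rewrite [e]splitr (le_trans (ler_normB _ _))// lerD//.
    rewrite (le_trans (QC _))// (@le_trans _ _ ((`|C1| + 1) * (e / 2 / (`|C1| + 1))))//.
      apply: (@le_trans _ _ ((`|C1| + 1) * `|xi - series u n|)).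
        by rewrite ler_wpM2r// (le_trans (ler_norm _))// lerDl.
      by rewrite ler_wpM2l// ltW.
    by rewrite mulrC divfK// gt_eqF.
  by apply: le_trans (rle n) _; move: rP; rewrite /= sub0r normrN; apply: le_trans; exact: ler_norm.
apply/ler_addgt0Pr => e e0.
move/cvgrPdist_le/(_ e e0) : sxi => [N _ /(_ N (leqnn _))/= sN].
rewrite -[xi](subrK (series u N)) addrC.
by apply: le_trans (ler_normD _ _) _; apply: lerD.
Qed.

(** Bounded preimages make the induced bijection from the quotient by the null space
bicontinuous. *)
Section Kernel.
Variables (R : realType) (X Z : normedModType R) (Q : X -> Z) (C1 C : R).
Hypotheses (Ql : linear Q) (QC : forall x, `|Q x| <= C1 * `|x|).
Hypothesis Qlift : forall v, exists2 x, Q x = v & `|x| <= C * `|v|.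

Definition null_space : {pred X} := [pred x | Q x == 0].

Lemma null_space_submod_closed : submod_closed null_space.
Proof.
have Q0 : Q 0 = 0 by apply/normr0_eq0/le_anti; rewrite normr_ge0 andbT (le_trans (QC _))// normr0 mulr0.
split=> [|a x y]; rewrite !inE ?Q0 ?eqxx// => /eqP x0 /eqP y0.
by rewrite Ql x0 y0 scaler0 addr0.
Qed.

Lemma linear_sub (x y : X) : Q (x - y) = Q x - Q y.
Proof. by rewrite addrC -scaleN1r Ql scaleN1r addrC. Qed.

Lemma linear_bounded_dist (x y : X) : `|Q x - Q y| <= C1 * `|x - y|.
Proof.
by rewrite -linear_sub QC.
Qed.

Lemma null_space_closed : closed [set x | x \in null_space].
Proof.
rewrite (_ : [set _ | _] = Q @^-1` [set 0]).
  apply: closed_comp; last exact/accessible_closed_set1/hausdorff_accessible/norm_hausdorff.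
  by move=> x _; apply: dist_le_continuous linear_bounded_dist _.
by apply/seteqP; split=> x /=; rewrite inE => /eqP.
Qed.

HB.instance Definition _ := GRing.isSubmodClosed.Build _ _ null_space
  null_space_submod_closed.

Definition null_subspace : closedSubspace X :=
  ClosedSubspace (subspace_pred := null_space) null_space_closed.

Local Notation XM := (quotient_space null_subspace).
Local Notation cos := (@coset R X null_subspace).

Definition quot_map (u : XM) : Z := Q (generic_quotient.repr u).

Lemma quot_map_coset x : quot_map (cos x) = Q x.
Proof.
have := repr_coset null_subspace x; rewrite /= inE => /eqP E.
by apply/eqP; rewrite -subr_eq0 -linear_sub E.
Qed.

Lemma quot_map_linear : linear quot_map.
Proof.
move=> a u v; have [x ->] := coset_surj u; have [y ->] := coset_surj v.
by rewrite -cosetZ -cosetD !quot_map_coset Ql.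
Qed.

Lemma quot_map_bound u : `|quot_map u| <= `|C1| * `|u|.
Proof.
apply/ler_addgt0Pr => e e0; have D0 : 0 < `|C1| + 1 by rewrite ltr_pwDr.
have [x <- xu] := quot_norm_lt u (divr_gt0 e0 D0).
rewrite quot_map_coset; apply: (le_trans (QC x)).
apply: (@le_trans _ _ (`|C1| * `|x|)); first by rewrite ler_wpM2r// ler_norm.
apply: (@le_trans _ _ (`|C1| * (quot_norm (cos x) + e / (`|C1| + 1)))).
  by rewrite ler_wpM2l// ltW.
rewrite mulrDr lerD2l mulrCA ler_piMr ?(ltW e0)//.
by rewrite ler_pdivrMr// mul1r lerDl.
Qed.

Definition quot_lift (v : Z) : XM := cos (projT1 (cid2 (Qlift v))).

Lemma quot_liftE v : exists2 x, quot_lift v = cos x & Q x = v /\ `|x| <= C * `|v|.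
Proof.
by rewrite /quot_lift; case: cid2 => x xv xC /=; exists x.
Qed.

Lemma quot_liftK : cancel quot_lift quot_map.
Proof. by move=> v; have [x -> [xv _]] := quot_liftE v; rewrite quot_map_coset. Qed.

Lemma quot_mapK : cancel quot_map quot_lift.
Proof.
move=> u; have [x ->] := coset_surj u; have [y -> [yx _]] := quot_liftE (quot_map (cos x)).
by apply/cosetP; rewrite /= inE linear_sub yx quot_map_coset subrr.
Qed.

Lemma quot_lift_linear : linear quot_lift.
Proof.
move=> a v w; apply: (can_inj quot_mapK); rewrite quot_liftK quot_map_linear.
by rewrite !quot_liftK.
Qed.

Lemma quot_lift_bound v : `|quot_lift v| <= C * `|v|.
Proof.
have [x -> [_ xC]] := quot_liftE v; apply: le_trans xC.
exact: (quot_norm_le (erefl (cos x))).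
Qed.

HB.instance Definition _ := GRing.isLinear.Build R XM Z *:%R quot_map quot_map_linear.
HB.instance Definition _ := GRing.isLinear.Build R Z XM *:%R quot_lift quot_lift_linear.

Lemma quotient_isomorphic : isomorphic XM Z.
Proof.
exists quot_map, quot_lift; split.
- apply: (@dist_le_continuous _ _ _ _ `|C1|) => u v; rewrite -linearB; exact: quot_map_bound.
- apply: (@dist_le_continuous _ _ _ _ C) => u v; rewrite -linearB; exact: quot_lift_bound.
- exact: quot_mapK.
- exact: quot_liftK.
Qed.

End Kernel.

(** * The polyhedral space with quotient Z *)

Lemma sum_half_powers (R : realFieldType) n : \sum_(m < n) 2^-1 ^+ m.+1 <= 1 :> R.
Proof.
suff E : \sum_(m < n) 2^-1 ^+ m.+1 = 1 - 2^-1 ^+ n :> R.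
  by rewrite E gerBl exprn_ge0 ?invr_ge0.
elim: n => [|n IH]; first by rewrite big_ord0 expr0 subrr.
by rewrite big_ord_recr/= IH exprS; field.
Qed.

Section Assembly.
Variables (R : realType) (Z : completeNormedModType R) (z : nat -> Z) (p : R).
Variable f : nat -> dual Z.
Hypothesis f_z : forall m n, f m (z n) = (m == n)%:R.
Hypothesis z_basis : unconditional_basis z.
Hypothesis p1 : 1 < p.
Hypothesis z_upper : upper_estimate p z.
Variable K : R.
Hypothesis K1 : 1 <= K.
Hypothesis KP : forall v (th : nat -> R) n, ternary th ->
  `|\sum_(m < n) (th m * f m v) *: z m| <= K * `|v|.

Let K0 : 0 < K. Proof. by rewrite (lt_le_trans ltr01). Qed.
Let ka : R := (8 * K)^-1.
Let ka0 : 0 < ka. Proof. by rewrite invr_gt0 mulr_gt0. Qed.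
Let h : R := 2 `^ p.
Let h1 : 1 <= h.
Proof. by rewrite (@le_trans _ _ 2) ?ler1n// le1r_powR ?ler1n// ltW. Qed.
Let z0 m : z m != 0. Proof. exact: (basis_neq0 f_z). Qed.

Let tree := grid_tree z0 ka0 h1.
Let nod := node z ka.
Let lv := node_lev z ka.
Let gr := grid z ka.
Let X := family_space (level_family R tree).
Let q i : Z := gr (nod i) (lv i) *: z (lv i).

(** The norm of the image is read off from a functional whose coefficients lie in
the p-dual, and then pairing_bound applies. *)
Lemma tree_synthesis_bound : exists2 C : R, 0 < C & forall (x : nat -> R) l M,
  (forall A, fam (level_family R tree) A -> (forall i, i \in A -> (i < l)%N) ->
     \sum_(i <- A) `|x i| <= M) ->
  `|\sum_(i < l) x i *: q i| <= C * M.
Proof.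
have [C C0 Ca] := norming_upper_dual f_z p1 z_upper.
set D : R := 4 * (4 + 32 * (1 - 2 / h) ^- 2).
have D0 : 0 < D by rewrite mulr_gt0// ltr_pwDl// mulr_ge0// invr_ge0 exprn_even_ge0.
exists (C * D); first by rewrite mulr_gt0.
move=> x l M xM.
pose n := (\max_(i < l) lv i).+1.
have lvn (i : 'I_l) : (lv i < n)%N by exact: (max_lev_lt tree (ltn_ord i)).
pose c m := \sum_(i < l | lv i == m) x i * gr (nod i) m.
have -> : \sum_(i < l) x i *: q i = \sum_(m < n) c m *: z m.
  rewrite (partition_big (fun i : 'I_l => Ordinal (lvn i)) xpredT)//=.
  apply: eq_bigr => m _; rewrite /c scaler_suml; apply: eq_big => [i|i /eqP <-].
    by rewrite -val_eqE.
  by rewrite /q scalerA.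
have [a aD] := Ca c n; move/le_trans; apply; rewrite -mulrA ler_wpM2l ?(ltW C0)//.
have -> : \sum_(m < n) a m * c m = \sum_(i < l) a (lv i) * gr (nod i) (lv i) * x i.
  rewrite [RHS](partition_big (fun i : 'I_l => Ordinal (lvn i)) xpredT)//=.
  apply: eq_bigr => m _; rewrite /c mulr_sumr; apply: eq_big => [i|i /eqP <-].
    by rewrite -val_eqE.
  by ring.
apply: (@le_trans _ _ (\sum_(i < l) `|a (lv i) * gr (nod i) (lv i) * x i|)).
  by apply: ler_sum => i _; exact: ler_norm.
apply: (@pairing_bound R p tree (solid_ball z) (fun i => gr (nod i)) p1 _ _ _ l x M xM a aD).
- by move=> i; exact: grid_solid.
- by move=> s t; exact: node_anc_grid.
- by move=> j m; exact: grid_tree_width.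
Qed.

(** A partial sum of the expansion of v, scaled by 1 / (2 K |v|), lies in half the
solid ball; its rounding to the grid therefore lies in the solid ball and is the
end of a branch. *)
Lemma grid_approximation (syn : X -> Z) : linear syn ->
  (forall j, syn (unit_vec _ j) = q j) ->
  forall v, exists2 xi, `|xi| <= 4 * K * `|v| & `|v - syn xi| <= 2^-1 * `|v|.
Proof.
move=> synl synq v.
have syn0 : syn 0 = 0 by have := synl (-1) 0 0; rewrite scaleN1r oppr0 addr0 scaleN1r addNr.
have synD x y : syn (x + y) = syn x + syn y by rewrite -[x]scale1r synl !scale1r.
have synZ (a : R) x : syn (a *: x) = a *: syn x by rewrite -[a *: x]addr0 synl syn0 addr0.
have syn_sum (r : seq nat) : syn (\sum_(j <- r) unit_vec _ j) = \sum_(j <- r) q j.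
  by elim: r => [|j r IH]; rewrite ?big_nil// !big_cons synD IH synq.
have [->|v0] := eqVneq v 0.
  by exists 0; rewrite ?syn0 ?subrr !normr0 ?mulr0.
have v0' : 0 < `|v| by rewrite normr_gt0.
have v4 : 0 < `|v| / 4 by rewrite divr_gt0.
move/cvgrPdist_le/(_ _ v4) : (@basis_expansion _ _ _ _ f_z z_basis v).
move=> [n _ /(_ n (leqnn _))/=]; rewrite seriesEord/= => vn.
pose t := 2 * K * `|v|.
have t0 : 0 < t by rewrite !mulr_gt0.
pose c m := (m < n)%:R * (t^-1 * f m v).
have csolid n' th : ternary th -> `|\sum_(m < n') (th m * c m) *: z m| <= 2^-1.
  move=> tth; have := KP v n' (ternary_mul tth (ternary_bool R (fun m => (m < n)%N))).
  rewrite (eq_bigr (fun m : 'I_n' => t *: ((th m * c m) *: z m))) => [|m _].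
    rewrite -scaler_sumr normrZ gtr0_norm// mulrC => /le_trans-/(_ (t * 2^-1)).
    rewrite [t * 2^-1]mulrC ler_pM2r//; apply; rewrite /t; lra.
  by rewrite scalerA /c; congr (_ *: _); field; rewrite gt_eqF.
pose s := mkseq (fun m => Num.floor (c m / mesh z ka m)) n.
have ss : size s = n by rewrite size_mkseq.
have mesh0 m : 0 < mesh z ka m by exact: mesh_gt0.
have err m : `|gr s m - c m| <= mesh z ka m.
  rewrite /gr /grid; have [mn|mn] := ltnP m n.
    rewrite nth_mkseq//; have cE : c m = (c m / mesh z ka m) * mesh z ka m by rewrite divfK// gt_eqF.
    rewrite {2}cE -mulrBl normrM (gtr0_norm (mesh0 m)) ler_piMl ?(ltW (mesh0 m))//.
    have := floor_le (c m / mesh z ka m); have := floorD1_gt (c m / mesh z ka m).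
    rewrite intrD ler_norml; set F := (Num.floor _)%:~R; set G := _ / _ => FG GF.
    by apply/andP; split; lra.
  rewrite nth_default ?ss// mul0r /c ltnNge mn/= mul0r subrr normr0 ltW//.
have errsum n' th : ternary th -> `|\sum_(m < n') (th m * (gr s m - c m)) *: z m| <= ka.
  move=> tth; rewrite (le_trans (ler_norm_sum _ _ _))//.
  apply: (@le_trans _ _ (\sum_(m < n') ka * 2^-1 ^+ m.+1)).
    apply: ler_sum => m _; rewrite normrZ -(mesh_norm ka z0) ler_wpM2r// normrM.
    rewrite (le_trans _ (err m))// ler_piMl//.
    by have /or3P[/eqP ->|/eqP ->|/eqP ->] := tth m; rewrite ?normr0 ?normrN ?normr1.
  by rewrite -mulr_sumr ler_piMr ?(ltW ka0)// sum_half_powers.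
have ka8 : ka <= 8^-1.
  by rewrite /ka lef_pV2 ?posrE// ?mulr_gt0// ler_peMr.
have sS : solid_ball z (gr s).
  move=> n' th tth.
  have -> : \sum_(m < n') (th m * gr s m) *: z m =
      \sum_(m < n') (th m * (gr s m - c m)) *: z m + \sum_(m < n') (th m * c m) *: z m.
    by rewrite -big_split/=; apply: eq_bigr => m _; rewrite -scalerDl -mulrDr subrK.
  apply: le_trans (ler_normD _ _) _.
  apply: le_trans (lerD (errsum n' th tth) (csolid n' th tth)) _; lra.
exists (t *: \sum_(j <- branch s) unit_vec _ j).
  rewrite normrZ gtr0_norm//; have := branch_norm z0 ka0 h1 sS.
  move=> /(ler_wpM2l (ltW t0))/le_trans; apply; rewrite /t; lra.
rewrite synZ syn_sum sum_branch ss.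
have -> : \sum_(k < n) q (code (take k.+1 s)) = \sum_(k < n) gr s k *: z k.
  apply: eq_bigr => k _; have ks : (k < size s)%N by rewrite ss.
  rewrite /q /lv (lev_branch sS ks) /nod (node_branch sS ks).
  by rewrite /gr grid_take ltnSn mul1r.
have -> : v - t *: \sum_(k < n) gr s k *: z k =
    (v - \sum_(m < n) f m v *: z m) - t *: \sum_(m < n) (1 * (gr s m - c m)) *: z m.
  rewrite -[RHS]addrA; congr (_ + _).
  rewrite -[in RHS]opprD; congr (- _); rewrite !scaler_sumr -big_split/=.
  apply: eq_bigr => m _; rewrite !scalerA -scalerDl; congr (_ *: _).
  rewrite /c ltn_ord /= mulr1n !mul1r mulrBr (mulrA t t^-1) mulfV ?gt_eqF//.
  by rewrite mul1r addrC subrK.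
have one : ternary (fun=> 1 : R) by move=> m; rewrite eqxx orbT.
rewrite (le_trans (ler_normB _ _))// normrZ gtr0_norm//.
have := lerD vn (ler_wpM2l (ltW t0) (errsum n (fun=> 1) one)).
move/le_trans; apply; rewrite /t /ka invfM.
rewrite [leLHS](_ : _ = 2^-1 * `|v|)//; field; rewrite gt_eqF//.
Qed.

Theorem polyhedral_quotient : exists X : completeNormedModType R,
  [/\ isomorphically_polyhedral X,
      exists x : nat -> X, unconditional_basis x &
      exists M : closedSubspace X, isomorphic (quotient_space M) Z].
Proof.
have [C C0 qC] := tree_synthesis_bound.
pose syn : X -> Z := synthesis q.
have synl : linear syn := synthesis_linear C0 qC.
have synC u : `|syn u| <= C * `|u| := synthesis_bound C0 qC u.
have appr := grid_approximation synl (synthesis_unit C0 qC).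
have lift := approx_lift synl (_ : 0 < 4 * K) synC appr.
exists X; split.
- exists (fun x : X => `|x|); split; last exact: level_space_polyhedral.
  split; last by exists 1, 1; split=> // x; rewrite !mul1r lexx.
  by split=> [x y|a x|x]; [exact: ler_normD|exact: normrZ|exact: normr0_eq0].
- by exists (unit_vec (level_family R tree)); exact: unit_vec_basis.
- exists (null_subspace synl synC); apply: quotient_isomorphic.
  by apply: lift; rewrite mulr_gt0.
Qed.

End Assembly.

Theorem theorem1p1 (R : realType) (Z : completeNormedModType R)
    (z : nat -> Z) (p : R) :
  shrinking_basis z -> unconditional_basis z ->
  1 < p -> upper_estimate p z ->
  exists X : completeNormedModType R,
    [/\ isomorphically_polyhedral X,
        exists x : nat -> X, unconditional_basis x &
        exists M : closedSubspace X, isomorphic (quotient_space M) Z].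
Proof.
move=> [_ [f [f_z _]]] z_basis p1 z_upper.
have [K K0 KP] := unconditional_constant f_z z_basis.
apply: (polyhedral_quotient f_z z_basis p1 z_upper (K := K + 1)).
  by rewrite lerDr ltW.
move=> v th n tth; apply: (le_trans (KP v th n tth)).
by rewrite ler_wpM2r// lerDl.
Qed.
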